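(* Let $\mathcal A$ be a Krull–Schmidt abelian category with almost split sequences and let $f_!\dashv f^*$ be an adjunction with Nakayama functor $\nu$, where $f^*:\mathcal A\to\mathcal C$. Assume that $f_!\dashv f^*$ is Iwanaga–Gorenstein of dimension $n\le1$. Then $\mathcal G_{f_!}\mathrm{proj}$ and $\mathcal G_{f_*}\mathrm{inj}$ have almost split sequences.
   Context: All functors are additive. Let $\mathcal A,\mathcal C$ be abelian categories and $f^*:\mathcal A\to\mathcal C$ a faithful functor with left adjoint $f_!:\mathcal C\to\mathcal A$. A Nakayama functor with respect to $f_!\dashv f^*$ is a functor $\nu:\mathcal A\to\mathcal A$ with a right adjoint $\nu^-:\mathcal A\to\mathcal A$ such that (a) $\nu\circ f_!$ is right adjoint to $f^*$, and (b) the unit of $\nu\dashv\nu^-$ induces a natural isomorphism $f_!\to\nu^-\circ\nu\circ f_!$. Put $f_*:=\nu\circ f_!$. Relative projective (resp. relative injective) objects of $\mathcal A$ are direct summands of objects in the essential image of $f_!$ (resp. $f_*$). $\mathcal G_{f_!}\mathrm{proj}$ is the full subcategory of $\mathcal A$ of objects $\operatorname{Ker}(Q_0\to Q_{-1})$ for exact complexes $Q_\bullet=\cdots\to Q_1\to Q_0\to Q_{-1}\to\cdots$ of relative projectives with $\nu(Q_\bullet)$ exact. $\mathcal G_{f_*}\mathrm{inj}$ is the full subcategory of objects $\operatorname{Ker}(J_0\to J_{-1})$ for exact complexes $J_\bullet$ of relative injectives with $\nu^-(J_\bullet)$ exact. Both are extension-closed in $\mathcal A$, hence exact categories. The derived functors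 $L_j\nu$ and $R^j\nu^-$ exist and are computed by resolutions by relative projectives, resp. coresolutions by relative injectives. The adjunction is Iwanaga–Gorenstein if there is an integer $n$ with $L_j\nu=0$ and $R^j\nu^-=0$ for all $j>n$; its dimension is the smallest such $n$. Krull–Schmidt: every object is a finite direct sum of objects with local endomorphism rings. A morphism $g:A\to A'$ in a category is right almost split if it is not a split epimorphism and every morphism $B\to A'$ which is not a split epimorphism factors through $g$; left almost split is dual. An exact sequence $0\to L\xrightarrow{f}M\xrightarrow{g}N\to0$ in an extension-closed subcategory of an abelian category is almost split if $f$ is left almost split and $g$ is right almost split in the subcategory. A Krull–Schmidt extension-closed subcategory of an abelian category has almost split sequences if for every indecomposable non-projective object (for its exact structure) there is an almost split sequence ending in it and for every indecomposable non-injective object there is an almost split sequence starting in it. *)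

(* Defs.v *)
From mathcomp Require Import all_boot all_algebra.

Set Implicit Arguments.
Unset Strict Implicit.
Unset Printing Implicit Defensive.

Import GRing.Theory.
Local Open Scope ring_scope.

(* Hom-groups are [zmodType]s and morphisms are compared with Leibniz equality.
   The choice structure carried by [zmodType] costs no generality
   classically. *)
Record preadditive := Preadditive {
  object :> Type;
  Hom : object -> object -> zmodType;
  idm : forall X, Hom X X;
  compm : forall X Y Z, Hom Y Z -> Hom X Y -> Hom X Z;
  comp_idl : forall X Y (f : Hom X Y), compm (idm Y) f = f;
  comp_idr : forall X Y (f : Hom X Y), compm f (idm X) = f;
  comp_assoc : forall W X Y Z (h : Hom Y Z) (g : Hom X Y) (f : Hom W X),
    compm h (compm g f) = compm (compm h g) f;
  comp_addl : forall X Y Z (g g' : Hom Y Z) (f : Hom X Y),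
    compm (g + g') f = compm g f + compm g' f;
  comp_addr : forall X Y Z (g : Hom Y Z) (f f' : Hom X Y),
    compm g (f + f') = compm g f + compm g f' }.

Arguments Hom {p} X Y.
Arguments idm {p} X.
Arguments compm {p X Y Z} g f.

Notation "g \oc f" := (compm g f) (at level 40, left associativity).

Section Preadditive.
Variable C : preadditive.
Implicit Types X Y Z K L M N : C.

Definition is_iso X Y (f : Hom X Y) : Prop :=
  exists g : Hom Y X, g \oc f = idm X /\ f \oc g = idm Y.

Definition isomorphic X Y : Prop := exists f : Hom X Y, is_iso f.

Definition mono X Y (f : Hom X Y) : Prop :=
  forall Z (g h : Hom Z X), f \oc g = f \oc h -> g = h.

Definition epi X Y (f : Hom X Y) : Prop :=
  forall Z (g h : Hom Y Z), g \oc f = h \oc f -> g = h.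

Definition split_mono X Y (f : Hom X Y) : Prop :=
  exists r : Hom Y X, r \oc f = idm X.

Definition split_epi X Y (f : Hom X Y) : Prop :=
  exists s : Hom Y X, f \oc s = idm Y.

Definition is_zero X : Prop :=
  (forall Y, exists! f : Hom X Y, True) /\
  (forall Y, exists! f : Hom Y X, True).

Definition is_biproduct X Y Z : Prop :=
  exists (iX : Hom X Z) (iY : Hom Y Z) (pX : Hom Z X) (pY : Hom Z Y),
    [/\ pX \oc iX = idm X, pY \oc iY = idm Y, pX \oc iY = 0, pY \oc iX = 0
      & iX \oc pX + iY \oc pY = idm Z].

Definition is_direct_sum (m : nat) (X : 'I_m -> C) Z : Prop :=
  exists (i : forall k, Hom (X k) Z) (p : forall k, Hom Z (X k)),
    [/\ forall k, p k \oc i k = idm (X k),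
        forall k l, k <> l -> p k \oc i l = 0
      & \sum_(k < m) i k \oc p k = idm Z].

Definition is_summand X Y : Prop := exists Z, is_biproduct X Z Y.

Definition is_kernel K X Y (f : Hom X Y) (k : Hom K X) : Prop :=
  f \oc k = 0 /\
  forall Z (h : Hom Z X), f \oc h = 0 -> exists! u : Hom Z K, k \oc u = h.

Definition is_cokernel X Y K (f : Hom X Y) (c : Hom Y K) : Prop :=
  c \oc f = 0 /\
  forall Z (h : Hom Y Z), h \oc f = 0 -> exists! u : Hom K Z, u \oc c = h.

Definition is_image I X Y (f : Hom X Y) (k : Hom I Y) : Prop :=
  exists (K : C) (c : Hom Y K), is_cokernel f c /\ is_kernel c k.

(* Exactness at [Y]: the image of [f] and the kernel of [g] agree as
   subobjects of [Y]. *)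
Definition exact_at X Y Z (f : Hom X Y) (g : Hom Y Z) : Prop :=
  exists (I : C) (k : Hom I Y), is_image f k /\ is_kernel g k.

Definition short_exact L M N (f : Hom L M) (g : Hom M N) : Prop :=
  is_kernel g f /\ is_cokernel f g.

(* [H] is Ker g / Im f. *)
Definition is_homology X Y Z (f : Hom X Y) (g : Hom Y Z) (H : C) : Prop :=
  exists (K : C) (k : Hom K Y) (f' : Hom X K) (q : Hom K H),
    [/\ is_kernel g k, k \oc f' = f & is_cokernel f' q].

Definition abelian : Prop :=
  (exists X, is_zero X) /\
  (forall X Y, exists Z, is_biproduct X Y Z) /\
  (forall X Y (f : Hom X Y), exists (K : C) (k : Hom K X), is_kernel f k) /\
  (forall X Y (f : Hom X Y), exists (K : C) (c : Hom Y K), is_cokernel f c) /\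
  (forall X Y (f : Hom X Y), mono f ->
     exists (Z : C) (g : Hom Y Z), is_kernel g f) /\
  (forall X Y (f : Hom X Y), epi f ->
     exists (Z : C) (g : Hom Z X), is_cokernel g f).

(* The ring End(X) is local: it is nonzero and its non-units are closed under
   addition. *)
Definition local_End X : Prop :=
  idm X <> 0 /\
  forall f g : Hom X X, ~ is_iso f -> ~ is_iso g -> ~ is_iso (f + g).

(* The differential [d i] goes from degree [i] to degree [i - 1]. *)
Definition exact_complex (Q : int -> C) (d : forall i, Hom (Q i) (Q (i - 1)))
  : Prop := forall i, exact_at (d i) (d (i - 1)).

(* Full subcategories are given by predicates on objects. *)
Section Subcategory.
Variable E : C -> Prop.

Definition extension_closed : Prop :=
  forall L M N (f : Hom L M) (g : Hom M N),
    short_exact f g -> E L -> E N -> E M.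

Definition krull_schmidt : Prop :=
  forall X, E X -> exists (m : nat) (Y : 'I_m -> C),
    (forall k, E (Y k) /\ local_End (Y k)) /\ is_direct_sum Y X.

Definition indecomposable X : Prop :=
  [/\ E X, ~ is_zero X
    & forall Y Z, E Y -> E Z -> is_biproduct Y Z X -> is_zero Y \/ is_zero Z].

Definition exact_in L M N (f : Hom L M) (g : Hom M N) : Prop :=
  [/\ E L, E M, E N & short_exact f g].

Definition projective_in P : Prop :=
  E P /\ forall L M N (f : Hom L M) (g : Hom M N), exact_in f g ->
    forall h : Hom P N, exists h' : Hom P M, g \oc h' = h.

Definition injective_in J : Prop :=
  E J /\ forall L M N (f : Hom L M) (g : Hom M N), exact_in f g ->
    forall h : Hom L J, exists h' : Hom M J, h' \oc f = h.

Definition right_almost_split X Y (g : Hom X Y) : Prop :=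
  ~ split_epi g /\
  forall Z (h : Hom Z Y), E Z -> ~ split_epi h ->
    exists h' : Hom Z X, g \oc h' = h.

Definition left_almost_split X Y (f : Hom X Y) : Prop :=
  ~ split_mono f /\
  forall Z (h : Hom X Z), E Z -> ~ split_mono h ->
    exists h' : Hom Y Z, h' \oc f = h.

Definition almost_split_sequence L M N (f : Hom L M) (g : Hom M N) : Prop :=
  [/\ exact_in f g, left_almost_split f & right_almost_split g].

(* The notion only makes sense for Krull-Schmidt extension-closed
   subcategories, so both conditions are part of it. *)
Definition has_almost_split_sequences : Prop :=
  [/\ krull_schmidt,
      extension_closed,
      forall N, indecomposable N -> ~ projective_in N ->
        exists (L M : C) (f : Hom L M) (g : Hom M N), almost_split_sequence f g
    & forall L, indecomposable L -> ~ injective_in L ->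
        exists (M N : C) (f : Hom L M) (g : Hom M N),
          almost_split_sequence f g].

End Subcategory.

Definition whole : C -> Prop := fun _ => True.

End Preadditive.

Arguments whole C X : clear implicits.

Record functor (C D : preadditive) := Functor {
  fobj :> C -> D;
  fmap : forall X Y, Hom X Y -> Hom (fobj X) (fobj Y);
  fmap_id : forall X, fmap (idm X) = idm (fobj X);
  fmap_comp : forall X Y Z (g : Hom Y Z) (f : Hom X Y),
    fmap (g \oc f) = fmap g \oc fmap f;
  fmap_add : forall X Y (f g : Hom X Y), fmap (f + g) = fmap f + fmap g }.

Arguments fmap {C D} F {X Y} f : rename.

Section CompFunctor.
Variables (C D E : preadditive) (G : functor D E) (F : functor C D).

Lemma comp_functor_id (X : C) : fmap G (fmap F (idm X)) = idm (G (F X)).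
Proof. by rewrite !fmap_id. Qed.

Lemma comp_functor_comp (X Y Z : C) (g : Hom Y Z) (f : Hom X Y) :
  fmap G (fmap F (g \oc f)) = fmap G (fmap F g) \oc fmap G (fmap F f).
Proof. by rewrite !fmap_comp. Qed.

Lemma comp_functor_add (X Y : C) (f g : Hom X Y) :
  fmap G (fmap F (f + g)) = fmap G (fmap F f) + fmap G (fmap F g).
Proof. by rewrite !fmap_add. Qed.

Definition comp_functor : functor C E :=
  @Functor C E (fun X => G (F X)) (fun X Y f => fmap G (fmap F f))
    comp_functor_id comp_functor_comp comp_functor_add.

End CompFunctor.

Definition faithful (C D : preadditive) (F : functor C D) : Prop :=
  forall (X Y : C) (f g : Hom X Y), fmap F f = fmap F g -> f = g.

(* [adjunction F G]: [F] is left adjoint to [G]. *)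
Record adjunction (C D : preadditive) (F : functor C D) (G : functor D C) :=
  Adjunction {
    adj_unit : forall X : C, Hom X (G (F X));
    adj_counit : forall Y : D, Hom (F (G Y)) Y;
    unit_natural : forall (X X' : C) (f : Hom X X'),
      adj_unit X' \oc f = fmap G (fmap F f) \oc adj_unit X;
    counit_natural : forall (Y Y' : D) (g : Hom Y Y'),
      adj_counit Y' \oc fmap F (fmap G g) = g \oc adj_counit Y;
    triangle_left : forall X : C,
      adj_counit (F X) \oc fmap F (adj_unit X) = idm (F X);
    triangle_right : forall Y : D,
      fmap G (adj_counit Y) \oc adj_unit (G Y) = idm (G Y) }.

Arguments adj_unit {C D F G} _ X.
Arguments adj_counit {C D F G} _ Y.

Definition in_essential_image (C D : preadditive) (F : functor C D) (Y : D)
  : Prop := exists X : C, isomorphic (F X) Y.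

(* [fS] stands for f_! and [fU] for f^*.
   In [nu_unit_iso], naturality of the transformation from [fS] to
   nu^- nu [fS] is automatic, so only invertibility of its components has to
   be required. *)
Record nakayama (A C : preadditive) (fS : functor C A) (fU : functor A C)
    (adj : adjunction fS fU) := Nakayama {
  nu : functor A A;
  nu_inv : functor A A;
  nu_adj : adjunction nu nu_inv;
  nu_fS_adj : adjunction fU (comp_functor nu fS);
  nu_unit_iso : forall X : C, is_iso (adj_unit nu_adj (fS X)) }.

Section Nakayama.
Variables (A C : preadditive) (fS : functor C A) (fU : functor A C).
Variables (adj : adjunction fS fU) (N : nakayama adj).

Definition f_lower_star : functor C A := comp_functor (nu N) fS.

Definition rel_projective (P : A) : Prop :=
  exists Y : A, in_essential_image fS Y /\ is_summand P Y.

Definition rel_injective (J : A) : Prop :=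
  exists Y : A, in_essential_image f_lower_star Y /\ is_summand J Y.

Definition Gproj (X : A) : Prop :=
  exists (Q : int -> A) (d : forall i, Hom (Q i) (Q (i - 1))),
    [/\ forall i, rel_projective (Q i),
        exact_complex d,
        exact_complex (fun i => fmap (nu N) (d i))
      & exists k : Hom X (Q 0), is_kernel (d 0) k].

Definition Ginj (X : A) : Prop :=
  exists (J : int -> A) (d : forall i, Hom (J i) (J (i - 1))),
    [/\ forall i, rel_injective (J i),
        exact_complex d,
        exact_complex (fun i => fmap (nu_inv N) (d i))
      & exists k : Hom X (J 0), is_kernel (d 0) k].

Definition is_resolution (X : A) (P : nat -> A)
    (d : forall i, Hom (P i.+1) (P i)) (e : Hom (P 0%N) X) : Prop :=
  [/\ forall i, rel_projective (P i), epi e, exact_at (d 0%N) e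
    & forall i, exact_at (d i.+1) (d i)].

Definition is_coresolution (X : A) (J : nat -> A)
    (d : forall i, Hom (J i) (J i.+1)) (e : Hom X (J 0%N)) : Prop :=
  [/\ forall i, rel_injective (J i), mono e, exact_at e (d 0%N)
    & forall i, exact_at (d i) (d i.+1)].

(* [H] is the value of the [j]-th left derived functor of [nu] at [X], computed
   as the homology in degree [j] of [nu] applied to a resolution of [X] by
   relative projectives; it does not depend on the resolution. *)
Definition left_derived_value (j : nat) (X H : A) : Prop :=
  exists (P : nat -> A) (d : forall i, Hom (P i.+1) (P i)) (e : Hom (P 0%N) X),
    is_resolution d e /\
    match j with
    | 0%N => exists c : Hom (nu N (P 0%N)) H, is_cokernel (fmap (nu N) (d 0%N)) c
    | i.+1 => is_homology (fmap (nu N) (d i.+1)) (fmap (nu N) (d i)) H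
    end.

Definition right_derived_value (j : nat) (X H : A) : Prop :=
  exists (J : nat -> A) (d : forall i, Hom (J i) (J i.+1)) (e : Hom X (J 0%N)),
    is_coresolution d e /\
    match j with
    | 0%N => exists k : Hom H (nu_inv N (J 0%N)),
               is_kernel (fmap (nu_inv N) (d 0%N)) k
    | i.+1 => is_homology (fmap (nu_inv N) (d i)) (fmap (nu_inv N) (d i.+1)) H
    end.

Definition derived_vanish_above (n : nat) : Prop :=
  forall j : nat, (n < j)%N -> forall X H : A,
    (left_derived_value j X H -> is_zero H) /\
    (right_derived_value j X H -> is_zero H).

Definition iwanaga_gorenstein_of_dim (n : nat) : Prop :=
  derived_vanish_above n /\
  forall m : nat, derived_vanish_above m -> (n <= m)%N.

End Nakayama.

(* Main.v *)
From mathcomp Require Import all_boot all_algebra.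
From Stdlib Require Import Classical ClassicalEpsilon.
From Stdlib Require Import FunctionalExtensionality PropExtensionality.
Require Import Defs.

(* Since L_2 nu = 0, every subobject X of a relative projective satisfies
   L_1 nu (X) = 0, so the Gorenstein projectives are exactly the subobjects of
   relative projectives; dually the Gorenstein injectives are the quotients of
   relative injectives, and nu and nu^- are inverse exact equivalences between
   the two.  The unit M -> nu^- nu M is a left approximation of M by a
   Gorenstein projective, so composing the almost split sequence of A starting
   at a Gorenstein projective L with it gives a left almost split morphism
   L -> R.  Over a suitable indecomposable summand of its cokernel the sequence
   does not split, and that summand is again Gorenstein projective, which yields
   an almost split sequence starting at L.  Almost split sequences ending at a
   Gorenstein injective are obtained dually, and the equivalence moves each
   kind to the other side. *)

Set Implicit Arguments.
Unset Strict Implicit.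
Unset Printing Implicit Defensive.

Import GRing.Theory.
Local Open Scope ring_scope.

(** * Morphisms and opposite categories *)

(** Passing from L_2 to L_1 needs relative projectives to be [nu]-acyclic, which is not assumed. It
    comes from the comonad f_! f^*: its counit is epi because f^* is faithful, and it splits at
    relative projectives, while nu f_! f^* = f_* f^* preserves monos, being a composite of right
    adjoints. No derived functor is constructed: acyclicity of X says that [nu] keeps every mono
    with cokernel X mono, and L_2 nu = 0 enters only as exactness, in degree 2, of [nu] applied to a
    resolution. The approximation M -> nu^- nu M is a left one: it reaches sequences starting at a
    Gorenstein projective but not those ending there, hence the detour through the Gorenstein
    injectives. The properties collected in [nakayama_dim1] are self-dual, so the injective half is
    the projective half read in [op]. *)

Section Composition.
Variable C : preadditive.
Implicit Types W X Y Z K : C.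

Lemma comp0l X Y Z (f : Hom X Y) : (0 : Hom Y Z) \oc f = 0.
Proof. by apply: (addrI (0 \oc f)); rewrite -comp_addl !addr0. Qed.

Lemma comp0r X Y Z (g : Hom Y Z) : g \oc (0 : Hom X Y) = 0.
Proof. by apply: (addrI (g \oc 0)); rewrite -comp_addr !addr0. Qed.

Lemma compNl X Y Z (g : Hom Y Z) (f : Hom X Y) : (- g) \oc f = - (g \oc f).
Proof. by apply: (addrI (g \oc f)); rewrite -comp_addl !subrr comp0l. Qed.

Lemma compNr X Y Z (g : Hom Y Z) (f : Hom X Y) : g \oc (- f) = - (g \oc f).
Proof. by apply: (addrI (g \oc f)); rewrite -comp_addr !subrr comp0r. Qed.

Lemma compBl X Y Z (g g' : Hom Y Z) (f : Hom X Y) :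
  (g - g') \oc f = g \oc f - g' \oc f.
Proof. by rewrite comp_addl compNl. Qed.

Lemma compBr X Y Z (g : Hom Y Z) (f f' : Hom X Y) :
  g \oc (f - f') = g \oc f - g \oc f'.
Proof. by rewrite comp_addr compNr. Qed.

Lemma comp_sumr X Y Z (m : nat) (g : Hom Y Z) (f : 'I_m -> Hom X Y) :
  g \oc (\sum_(k < m) f k) = \sum_(k < m) (g \oc f k).
Proof.
exact: (big_morph (fun h : Hom X Y => g \oc h)
  (fun h h' => comp_addr g h h') (comp0r _ g)).
Qed.

Lemma mono_zero X Y (f : Hom X Y) :
  (forall Z (h : Hom Z X), f \oc h = 0 -> h = 0) -> mono f.
Proof.
move=> f0 Z g h fgh; apply/eqP; rewrite -subr_eq0; apply/eqP/f0.
by rewrite compBr fgh subrr.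
Qed.

Lemma mono_eq0 X Y Z (f : Hom X Y) (h : Hom Z X) :
  mono f -> f \oc h = 0 -> h = 0.
Proof. by move=> fm fh; apply: fm; rewrite comp0r. Qed.

Lemma epi_zero X Y (f : Hom X Y) :
  (forall Z (h : Hom Y Z), h \oc f = 0 -> h = 0) -> epi f.
Proof.
move=> f0 Z g h fgh; apply/eqP; rewrite -subr_eq0; apply/eqP/f0.
by rewrite compBl fgh subrr.
Qed.

Lemma epi_eq0 X Y Z (f : Hom X Y) (h : Hom Y Z) :
  epi f -> h \oc f = 0 -> h = 0.
Proof. by move=> fm fh; apply: fm; rewrite comp0l. Qed.

Lemma mono_comp X Y Z (g : Hom Y Z) (f : Hom X Y) :
  mono g -> mono f -> mono (g \oc f).
Proof. by move=> gm fm W a b; rewrite -!comp_assoc => /gm /fm. Qed.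

Lemma epi_comp X Y Z (g : Hom Y Z) (f : Hom X Y) :
  epi g -> epi f -> epi (g \oc f).
Proof. by move=> gm fm W a b; rewrite !comp_assoc => /fm /gm. Qed.

Lemma mono_of_comp X Y Z (g : Hom Y Z) (f : Hom X Y) :
  mono (g \oc f) -> mono f.
Proof. by move=> gfm W a b fab; apply: gfm; rewrite -!comp_assoc fab. Qed.

Lemma epi_of_comp X Y Z (g : Hom Y Z) (f : Hom X Y) :
  epi (g \oc f) -> epi g.
Proof. by move=> gfm W a b fab; apply: gfm; rewrite !comp_assoc fab. Qed.

Lemma mono_idm X : mono (idm X).
Proof. by move=> Z g h; rewrite !comp_idl. Qed.

Lemma epi_idm X : epi (idm X).
Proof. by move=> Z g h; rewrite !comp_idr. Qed.

Lemma retract_mono X Y (f : Hom X Y) (r : Hom Y X) : r \oc f = idm X -> mono f.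
Proof. by move=> rf; apply: (@mono_of_comp _ _ _ r); rewrite rf; exact: mono_idm. Qed.

Lemma section_epi X Y (f : Hom X Y) (s : Hom Y X) : f \oc s = idm Y -> epi f.
Proof. by move=> fs; apply: (@epi_of_comp _ _ _ _ s); rewrite fs; exact: epi_idm. Qed.

Lemma iso_mono X Y (f : Hom X Y) : is_iso f -> mono f.
Proof. by case=> g [gf _]; exact: retract_mono gf. Qed.

Lemma iso_epi X Y (f : Hom X Y) : is_iso f -> epi f.
Proof. by case=> g [_ fg]; exact: section_epi fg. Qed.

Lemma kernel_mono K X Y (f : Hom X Y) (k : Hom K X) : is_kernel f k -> mono k.
Proof.
move=> [fk ker_u]; apply: mono_zero => Z h kh.
have [|u [_ uniq]] := ker_u Z 0; first by rewrite comp0r.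
by rewrite -(uniq h kh) (uniq 0) ?comp0r.
Qed.

Lemma cokernel_epi X Y K (f : Hom X Y) (c : Hom Y K) : is_cokernel f c -> epi c.
Proof.
move=> [cf cok_u]; apply: epi_zero => Z h hc.
have [|u [_ uniq]] := cok_u Z 0; first by rewrite comp0l.
by rewrite -(uniq h hc) (uniq 0) ?comp0l.
Qed.

Lemma kernelI K X Y (f : Hom X Y) (k : Hom K X) :
  f \oc k = 0 -> mono k ->
  (forall Z (h : Hom Z X), f \oc h = 0 -> exists u, k \oc u = h) ->
  is_kernel f k.
Proof.
move=> fk km fact; split=> // Z h /fact [u ku].
by exists u; split=> // v kv; apply: km; rewrite ku kv.
Qed.

Lemma cokernelI X Y K (f : Hom X Y) (c : Hom Y K) :
  c \oc f = 0 -> epi c ->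
  (forall Z (h : Hom Y Z), h \oc f = 0 -> exists u, u \oc c = h) ->
  is_cokernel f c.
Proof.
move=> cf ce fact; split=> // Z h /fact [u uc].
by exists u; split=> // v vc; apply: ce; rewrite uc vc.
Qed.

Lemma kernel_lift K X Y Z (f : Hom X Y) (k : Hom K X) (h : Hom Z X) :
  is_kernel f k -> f \oc h = 0 -> exists u, k \oc u = h.
Proof. by move=> [_ ker_u] /ker_u [u [ku _]]; exists u. Qed.

Lemma cokernel_desc X Y K Z (f : Hom X Y) (c : Hom Y K) (h : Hom Y Z) :
  is_cokernel f c -> h \oc f = 0 -> exists u, u \oc c = h.
Proof. by move=> [_ cok_u] /cok_u [u [uc _]]; exists u. Qed.

Lemma short_exact_comp0 X Y Z (f : Hom X Y) (g : Hom Y Z) :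
  short_exact f g -> g \oc f = 0.
Proof. by case=> -[]. Qed.

Lemma short_exact_mono X Y Z (f : Hom X Y) (g : Hom Y Z) :
  short_exact f g -> mono f.
Proof. by case=> /kernel_mono. Qed.

Lemma short_exact_epi X Y Z (f : Hom X Y) (g : Hom Y Z) :
  short_exact f g -> epi g.
Proof. by case=> _ /cokernel_epi. Qed.

Lemma short_exact_iso_l X X' Y Z (f : Hom X Y) (g : Hom Y Z) (e : Hom X' X) :
  is_iso e -> short_exact f g -> short_exact (f \oc e) g.
Proof.
move=> ie [kf cg]; have [e' [e'e ee']] := ie; split.
- apply: kernelI.
  + by rewrite comp_assoc kf.1 comp0l.
  + by apply: mono_comp; [exact: kernel_mono kf | exact: iso_mono].
  + move=> T h /(kernel_lift kf) [u <-]; exists (e' \oc u).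
    by rewrite -comp_assoc (comp_assoc e) ee' comp_idl.
- apply: cokernelI.
  + by rewrite comp_assoc cg.1 comp0l.
  + exact: cokernel_epi cg.
  + move=> T h hfe; apply: (cokernel_desc cg).
    by apply: (iso_epi ie); rewrite comp0l -comp_assoc.
Qed.

Lemma is_zero_idm X : is_zero X <-> idm X = 0.
Proof.
split=> [[toX _]|id0].
  by have [f [_ uniq]] := toX X; rewrite -(uniq (idm X) I) -(uniq 0 I).
split=> Y; exists 0; split=> // f _.
  by rewrite -[f]comp_idr id0 comp0r.
by rewrite -[f]comp_idl id0 comp0l.
Qed.

(* Exactness at the middle term, in a form that dualizes to itself. *)
Definition exact_pair X Y Z (f : Hom X Y) (g : Hom Y Z) : Prop :=
  g \oc f = 0 /\
  forall K L (k : Hom K Y) (c : Hom Y L), g \oc k = 0 -> c \oc f = 0 ->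
    c \oc k = 0.

Lemma split_mono_section K Y X (f : Hom K Y) (g : Hom Y X) (r : Hom Y K) :
  short_exact f g -> r \oc f = idm K -> exists s, g \oc s = idm X.
Proof.
move=> ex rf; have [_ cg] := ex.
have [|s sg] := cokernel_desc (h := idm Y - f \oc r) cg.
  by rewrite compBl comp_idl -comp_assoc rf comp_idr subrr.
exists s; apply: (short_exact_epi ex).
rewrite -comp_assoc sg compBr comp_idr comp_assoc (short_exact_comp0 ex).
by rewrite comp0l subr0 comp_idl.
Qed.

Lemma split_epi_retraction K Y X (f : Hom K Y) (g : Hom Y X) (s : Hom X Y) :
  short_exact f g -> g \oc s = idm X -> exists r, r \oc f = idm K.
Proof.
move=> ex gs; have [kf _] := ex.
have [|r fr] := kernel_lift (h := idm Y - s \oc g) kf.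
  by rewrite compBr comp_idr comp_assoc gs comp_idl subrr.
exists r; apply: (short_exact_mono ex).
rewrite comp_assoc fr compBl comp_idl -comp_assoc (short_exact_comp0 ex).
by rewrite comp0r subr0 comp_idr.
Qed.

Lemma biproduct_swap X Y Z : is_biproduct X Y Z -> is_biproduct Y X Z.
Proof.
move=> [iX [iY [pX [pY [a b c d e]]]]]; exists iY, iX, pY, pX.
by split=> //; rewrite addrC.
Qed.

Lemma biproduct_retract X Y Z : is_biproduct X Y Z ->
  exists (i : Hom X Z) (p : Hom Z X), p \oc i = idm X.
Proof. by move=> [iX [iY [pX [pY [a _ _ _ _]]]]]; exists iX, pX. Qed.

Lemma iso_comp X Y Z (g : Hom Y Z) (f : Hom X Y) :
  is_iso g -> is_iso f -> is_iso (g \oc f).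
Proof.
move=> [g' [g'g gg']] [f' [f'f ff']]; exists (f' \oc g'); split.
  by rewrite -comp_assoc (comp_assoc g') g'g comp_idl.
by rewrite -comp_assoc (comp_assoc f) ff' comp_idl.
Qed.

End Composition.

Section Opposite.

(** Objects and hom-groups are reused, so kernels of [op C] unfold to cokernels of [C] and left
    almost split to right almost split. Most transport lemmas below therefore only repack
    conjunctions. *)
Definition op (C : preadditive) : preadditive :=
  @Preadditive (object C) (fun X Y => @Hom C Y X) (fun X => idm X)
    (fun X Y Z g f => f \oc g)
    (fun X Y f => comp_idr f) (fun X Y f => comp_idl f)
    (fun W X Y Z h g f => esym (comp_assoc f g h))
    (fun X Y Z g g' f => comp_addr f g g')
    (fun X Y Z g f f' => comp_addl f f' g).

Definition op_functor (C D : preadditive) (F : functor C D) :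
    functor (op C) (op D) :=
  @Functor (op C) (op D) (fobj F) (fun X Y f => fmap F f)
    (fun X => fmap_id F X) (fun X Y Z g f => fmap_comp F f g)
    (fun X Y f g => fmap_add F f g).

Definition op_adjunction (C D : preadditive) (F : functor C D)
    (G : functor D C) (adj : adjunction F G) :
    adjunction (op_functor G) (op_functor F) :=
  @Adjunction (op D) (op C) (op_functor G) (op_functor F)
    (fun Y => adj_counit adj Y) (fun X => adj_unit adj X)
    (fun Y Y' g => esym (counit_natural adj g))
    (fun X X' f => esym (unit_natural adj f))
    (fun Y => triangle_right adj Y) (fun X => triangle_left adj X).

Variable C : preadditive.

Lemma op_is_iso (X Y : C) (f : Hom X Y) :
  is_iso f -> @is_iso (op C) Y X f.
Proof. by move=> [g [gf fg]]; exists g. Qed.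

Lemma is_iso_op (X Y : C) (f : Hom X Y) :
  @is_iso (op C) Y X f -> is_iso f.
Proof. by move=> [g [gf fg]]; exists g. Qed.

Lemma op_short_exact (X Y Z : C) (f : Hom X Y) (g : Hom Y Z) :
  short_exact f g -> @short_exact (op C) Z Y X g f.
Proof. by move=> [kf cg]; split. Qed.

Lemma short_exact_op (X Y Z : C) (f : Hom X Y) (g : Hom Y Z) :
  @short_exact (op C) Z Y X g f -> short_exact f g.
Proof. by move=> [kf cg]; split. Qed.

Lemma op_biproduct (X Y Z : C) :
  is_biproduct X Y Z -> @is_biproduct (op C) X Y Z.
Proof. by move=> [iX [iY [pX [pY []]]]]; exists pX, pY, iX, iY. Qed.

Lemma biproduct_op (X Y Z : C) :
  @is_biproduct (op C) X Y Z -> is_biproduct X Y Z.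
Proof. by move=> [iX [iY [pX [pY []]]]]; exists pX, pY, iX, iY. Qed.

Lemma op_zero (X : C) : is_zero X -> @is_zero (op C) X.
Proof. by case. Qed.

Lemma zero_op (X : C) : @is_zero (op C) X -> is_zero X.
Proof. by case. Qed.

Lemma op_abelian : abelian C -> abelian (op C).
Proof.
move=> [[O zO] [bip [ker [cok [mk ec]]]]]; split; last split; last split;
  last split; last split.
- by exists O; exact: op_zero.
- by move=> X Y; have [Z /op_biproduct] := bip X Y; exists Z.
- by move=> X Y f; exact: (cok Y X f).
- by move=> X Y f; exact: (ker Y X f).
- by move=> X Y f fm; exact: (ec Y X f fm).
- by move=> X Y f fe; exact: (mk Y X f fe).
Qed.

Lemma op_local_End (X : C) : local_End X -> @local_End (op C) X.
Proof.
move=> [id0 loc]; split=> // f g nf ng /is_iso_op.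
by apply: loc => /op_is_iso.
Qed.

Lemma local_End_op (X : C) : @local_End (op C) X -> local_End X.
Proof.
move=> [id0 loc]; split=> // f g nf ng /op_is_iso.
by apply: loc => /is_iso_op.
Qed.

Lemma op_krull_schmidt (E : C -> Prop) :
  krull_schmidt E -> @krull_schmidt (op C) E.
Proof.
move=> ks X /ks [m [Y [EY [i [p [pi0 pil ip]]]]]]; exists m, Y; split.
  by move=> k; have [? ?] := EY k; split=> //; exact: op_local_End.
exists p, i; split=> // k l kl; apply: (pil l k); exact: nesym.
Qed.

Lemma krull_schmidt_op (E : C -> Prop) :
  @krull_schmidt (op C) E -> krull_schmidt E.
Proof.
move=> ks X /ks [m [Y [EY [i [p [pi0 pil ip]]]]]]; exists m, Y; split.
  by move=> k; have [? ?] := EY k; split=> //; exact: local_End_op.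
exists p, i; split=> // k l kl; apply: (pil l k); exact: nesym.
Qed.

Lemma op_extension_closed (E : C -> Prop) :
  extension_closed E -> @extension_closed (op C) E.
Proof. by move=> ext L M N f g /short_exact_op ex EL EN; exact: ext ex EN EL. Qed.

Lemma extension_closed_op (E : C -> Prop) :
  @extension_closed (op C) E -> extension_closed E.
Proof. by move=> ext L M N f g /op_short_exact ex EL EN; exact: ext ex EN EL. Qed.

Lemma op_indecomposable (E : C -> Prop) (X : C) :
  indecomposable E X -> @indecomposable (op C) E X.
Proof.
move=> [EX nz ind]; split=> [//|/zero_op //|Y Z EY EZ /biproduct_op b].
by have [/op_zero|/op_zero] := ind Y Z EY EZ b; [left|right].
Qed.

Lemma indecomposable_op (E : C -> Prop) (X : C) :
  @indecomposable (op C) E X -> indecomposable E X.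
Proof.
move=> [EX nz ind]; split=> [//|/op_zero //|Y Z EY EZ /op_biproduct b].
by have [/zero_op|/zero_op] := ind Y Z EY EZ b; [left|right].
Qed.

Lemma op_exact_in (E : C -> Prop) (X Y Z : C) (f : Hom X Y) (g : Hom Y Z) :
  exact_in E f g -> @exact_in (op C) E Z Y X g f.
Proof. by move=> [? ? ? /op_short_exact]; split. Qed.

Lemma exact_in_op (E : C -> Prop) (X Y Z : C) (f : Hom X Y) (g : Hom Y Z) :
  @exact_in (op C) E Z Y X g f -> exact_in E f g.
Proof. by move=> [? ? ? /short_exact_op]; split. Qed.

Lemma op_projective_in (E : C -> Prop) (X : C) :
  projective_in E X -> @injective_in (op C) E X.
Proof. by move=> [EX pr]; split=> // L M N f g /exact_in_op /pr. Qed.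

Lemma projective_in_op (E : C -> Prop) (X : C) :
  @projective_in (op C) E X -> injective_in E X.
Proof. by move=> [EX pr]; split=> // L M N f g /op_exact_in /pr. Qed.

Lemma op_injective_in (E : C -> Prop) (X : C) :
  injective_in E X -> @projective_in (op C) E X.
Proof. by move=> [EX pr]; split=> // L M N f g /exact_in_op /pr. Qed.

Lemma injective_in_op (E : C -> Prop) (X : C) :
  @injective_in (op C) E X -> projective_in E X.
Proof. by move=> [EX pr]; split=> // L M N f g /op_exact_in /pr. Qed.

Lemma op_almost_split (E : C -> Prop) (X Y Z : C) (f : Hom X Y) (g : Hom Y Z) :
  almost_split_sequence E f g -> @almost_split_sequence (op C) E Z Y X g f.
Proof. by move=> [/op_exact_in ? ? ?]; split. Qed.

Lemma almost_split_op (E : C -> Prop) (X Y Z : C) (f : Hom X Y) (g : Hom Y Z) :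
  @almost_split_sequence (op C) E Z Y X g f -> almost_split_sequence E f g.
Proof. by move=> [/exact_in_op ? ? ?]; split. Qed.

End Opposite.

Definition starting_almost_split (C : preadditive) (E : C -> Prop) : Prop :=
  forall L : C, indecomposable E L -> ~ injective_in E L ->
    exists (M N : C) (f : Hom L M) (g : Hom M N), almost_split_sequence E f g.

Definition ending_almost_split (C : preadditive) (E : C -> Prop) : Prop :=
  forall N : C, indecomposable E N -> ~ projective_in E N ->
    exists (L M : C) (f : Hom L M) (g : Hom M N), almost_split_sequence E f g.

Lemma op_ending_almost_split (C : preadditive) (E : C -> Prop) :
  ending_almost_split E -> @starting_almost_split (op C) E.
Proof.
move=> ass N /indecomposable_op iN nN.
have [|L [M [f [g /op_almost_split fg]]]] := ass N iN.
  by move=> /op_projective_in.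
by exists M, L, g, f.
Qed.

Lemma op_starting_almost_split (C : preadditive) (E : C -> Prop) :
  starting_almost_split E -> @ending_almost_split (op C) E.
Proof.
move=> ass N /indecomposable_op iN nN.
have [|L [M [f [g /op_almost_split fg]]]] := ass N iN.
  by move=> /op_injective_in.
by exists M, L, g, f.
Qed.

Lemma starting_almost_split_op (C : preadditive) (E : C -> Prop) :
  @starting_almost_split (op C) E -> ending_almost_split E.
Proof.
move=> ass N /op_indecomposable iN nN.
have [|L [M [f [g /almost_split_op fg]]]] := ass N iN.
  by move=> /injective_in_op.
by exists M, L, g, f.
Qed.

Lemma ending_almost_split_op (C : preadditive) (E : C -> Prop) :
  @ending_almost_split (op C) E -> starting_almost_split E.
Proof.
move=> ass N /op_indecomposable iN nN.
have [|L [M [f [g /almost_split_op fg]]]] := ass N iN.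
  by move=> /projective_in_op.
by exists M, L, g, f.
Qed.

(** * Abelian categories and adjunctions *)

Section Abelian.
Variable C : preadditive.
Hypothesis abC : abelian C.
Implicit Types K L W X Y Z : C.

Lemma biproduct_ex X Y : exists Z, is_biproduct X Y Z.
Proof. by have [_ [bip _]] := abC; exact: bip. Qed.

Lemma kernel_ex X Y (f : Hom X Y) : exists K (k : Hom K X), is_kernel f k.
Proof. by have [_ [_ [ker _]]] := abC; exact: ker. Qed.

Lemma cokernel_ex X Y (f : Hom X Y) : exists K (c : Hom Y K), is_cokernel f c.
Proof. by have [_ [_ [_ [cok _]]]] := abC; exact: cok. Qed.

Lemma kernel_of_cokernel X Y Z (f : Hom X Y) (c : Hom Y Z) :
  mono f -> is_cokernel f c -> is_kernel c f.
Proof.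
move=> fm cf; have [_ [_ [_ [_ [mk _]]]]] := abC.
have [W [g gf]] := mk _ _ _ fm.
have [h hc] := cokernel_desc cf gf.1.
apply: kernelI fm _; first exact: cf.1.
move=> T x cx; apply: (kernel_lift gf).
by rewrite -hc -comp_assoc cx comp0r.
Qed.

Lemma cokernel_of_kernel X Y Z (f : Hom Y Z) (k : Hom X Y) :
  epi f -> is_kernel f k -> is_cokernel k f.
Proof.
move=> fe kf; have [_ [_ [_ [_ [_ ec]]]]] := abC.
have [W [g gf]] := ec _ _ _ fe.
have [h hc] := kernel_lift kf gf.1.
apply: cokernelI fe _; first exact: kf.1.
move=> T x xk; apply: (cokernel_desc gf).
by rewrite -hc comp_assoc xk comp0l.
Qed.

Lemma mono_short_exact X Y (f : Hom X Y) :
  mono f -> exists Z (g : Hom Y Z), short_exact f g.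
Proof.
move=> fm; have [Z [g cg]] := cokernel_ex f.
by exists Z, g; split=> //; exact: kernel_of_cokernel.
Qed.

Lemma epi_short_exact Y Z (g : Hom Y Z) :
  epi g -> exists X (f : Hom X Y), short_exact f g.
Proof.
move=> ge; have [X [f kf]] := kernel_ex g.
by exists X, f; split=> //; exact: cokernel_of_kernel.
Qed.

Lemma mono_epi_iso X Y (f : Hom X Y) : mono f -> epi f -> is_iso f.
Proof.
move=> fm fe; have [Z [g [kf cg]]] := mono_short_exact fm.
have g0 : g = 0 by apply: (epi_eq0 fe); exact: kf.1.
have [|s fs] := kernel_lift (h := idm Y) kf; first by rewrite g0 comp0l.
exists s; split=> //; apply: fm.
by rewrite comp_assoc fs comp_idl comp_idr.
Qed.

(** The monic part is the kernel of the cokernel of [f]. If [h] kills [e], then [f] factors through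
    the smaller subobject cut out by [h]; that subobject is itself a kernel, hence contains [m], so
    [h] is zero. *)
Lemma image_factorization X Y (f : Hom X Y) :
  exists I (e : Hom X I) (m : Hom I Y), [/\ epi e, mono m & m \oc e = f].
Proof.
have [Z [c cf]] := cokernel_ex f.
have [I [m km]] := kernel_ex c.
have [e me] := kernel_lift km cf.1.
have mm := kernel_mono km.
exists I, e, m; split=> //; apply: epi_zero => T h he.
have [K [k kk]] := kernel_ex h.
have [e' ke'] := kernel_lift kk he.
have [Z' [c' [kc' cc']]] := mono_short_exact (mono_comp mm (kernel_mono kk)).
have [|d dc] := cokernel_desc (h := c') cf.
  by rewrite -me -ke' !comp_assoc -(comp_assoc c') kc'.1 comp0l.
have [|u mku] := kernel_lift (h := m) kc'.
  by rewrite -dc -comp_assoc km.1 comp0r.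
have ku : k \oc u = idm I.
  by apply: mm; rewrite comp_assoc mku comp_idr.
by rewrite -[h]comp_idr -ku comp_assoc kk.1 comp0l.
Qed.

(** * Pullbacks and diagram chases with generalized elements *)

Definition is_pullback W X Y Z (f : Hom X Z) (g : Hom Y Z)
    (p : Hom W X) (q : Hom W Y) : Prop :=
  [/\ f \oc p = g \oc q,
      forall T (a : Hom T X) (b : Hom T Y), f \oc a = g \oc b ->
        exists t, p \oc t = a /\ q \oc t = b
    & forall T (s t : Hom T W), p \oc s = p \oc t -> q \oc s = q \oc t -> s = t].

Lemma pullback_sym W X Y Z (f : Hom X Z) (g : Hom Y Z)
    (p : Hom W X) (q : Hom W Y) :
  is_pullback f g p q -> is_pullback g f q p.
Proof.
move=> [fg lift uniq]; split=> [//|T a b ab|T s t qst pst]; last exact: uniq.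
by have [t [? ?]] := lift T b a (esym ab); exists t.
Qed.

(** The pullback is the kernel of [d] on the biproduct. If [f] is epi, so is [d], which is then the
    cokernel of that kernel; a map killing [q] factors through [d] by a map that kills [f]. *)
Lemma pullback_ex X Y Z (f : Hom X Z) (g : Hom Y Z) :
  exists W (p : Hom W X) (q : Hom W Y),
    is_pullback f g p q /\ (epi f -> epi q).
Proof.
have [S [iX [iY [pX [pY [pi1 pi2 pi3 pi4 ip]]]]]] := biproduct_ex X Y.
pose d := f \oc pX - g \oc pY.
have diX : d \oc iX = f.
  by rewrite compBl -!comp_assoc pi1 pi4 comp0r comp_idr subr0.
have diY : d \oc iY = - g.
  by rewrite compBl -!comp_assoc pi2 pi3 comp0r comp_idr sub0r.
have [W [k kk]] := kernel_ex d.
exists W, (pX \oc k), (pY \oc k); split; first split.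
- by apply/eqP; rewrite -subr_eq0 !comp_assoc -compBl kk.1.
- move=> T a b fagb.
  have [|t kt] := kernel_lift (h := iX \oc a + iY \oc b) kk.
    by rewrite comp_addr !comp_assoc diX diY compNl fagb subrr.
  exists t; rewrite -!comp_assoc kt !comp_addr !comp_assoc pi1 pi2 pi3 pi4.
  by rewrite !comp0l !comp_idl addr0 add0r.
- move=> T s t; rewrite -!comp_assoc => pst qst; apply: (kernel_mono kk).
  rewrite -[k \oc s]comp_idl -[k \oc t]comp_idl -ip !comp_addl -!comp_assoc.
  by rewrite pst qst.
- move=> fe; apply: epi_zero => T h hq.
  have de : epi d by apply: (@epi_of_comp _ _ _ _ _ iX); rewrite diX.
  have cd := cokernel_of_kernel de kk.
  have [|h' h'd] := cokernel_desc (h := h \oc pY) cd.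
    by rewrite -comp_assoc.
  have h'0 : h' = 0.
    apply: (epi_eq0 fe); rewrite -diX comp_assoc h'd -comp_assoc pi4.
    by rewrite comp0r.
  by rewrite -[h]comp_idr -pi2 comp_assoc -h'd h'0 !comp0l.
Qed.

Lemma pullback_kernel K W X Y Z (f : Hom X Z) (g : Hom Y Z)
    (p : Hom W X) (q : Hom W Y) (k : Hom K X) :
  is_pullback f g p q -> is_kernel f k ->
  exists k' : Hom K W, p \oc k' = k /\ is_kernel q k'.
Proof.
move=> [fg lift uniq] kk.
have [|k' [pk' qk']] := lift _ k 0; first by rewrite kk.1 comp0r.
exists k'; split=> //; apply: kernelI => [//||T h qh].
  by apply: (@mono_of_comp _ _ _ _ p); rewrite pk'; exact: kernel_mono kk.
have [|u ku] := kernel_lift (h := p \oc h) kk.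
  by rewrite comp_assoc fg -comp_assoc qh comp0r.
exists u; apply: uniq; first by rewrite comp_assoc pk'.
by rewrite comp_assoc qk' comp0l.
Qed.

Lemma pullback_mono W X Y Z (f : Hom X Z) (g : Hom Y Z)
    (p : Hom W X) (q : Hom W Y) :
  is_pullback f g p q -> mono g -> mono p.
Proof.
move=> [fg _ uniq] gm T s t pst; apply: uniq => //; apply: gm.
by rewrite !comp_assoc -fg -!comp_assoc pst.
Qed.

Lemma pullback_short_exact K Y X X' (i : Hom K Y) (p : Hom Y X)
    (h : Hom X' X) :
  short_exact i p ->
  exists Y' (i' : Hom K Y') (p' : Hom Y' X') (h' : Hom Y' Y),
    [/\ short_exact i' p', h' \oc i' = i, is_pullback p h h' p'
      & epi h -> epi h'].
Proof.
move=> ex; have [W [h' [p' [pb pe]]]] := pullback_ex p h.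
have [i' [hi' ki']] := pullback_kernel pb ex.1.
have p'e := pe (short_exact_epi ex).
exists W, i', p', h'; split=> //; first by split=> //; exact: cokernel_of_kernel.
(* [pullback_ex] transfers epimorphy only from its first map. A second pullback with the roles
   exchanged has an epi projection onto [Y], which factors through [h']. *)
move=> he; have [W2 [q2 [h2 [[c2 _ _] h2e]]]] := pullback_ex h p.
have [_ lift _] := pb; have [t [ht _]] := lift _ _ _ (esym c2).
by apply: (@epi_of_comp _ _ _ _ _ t); rewrite ht; exact: h2e.
Qed.

(* Generalized elements: a morphism into [Y] plays the role of an element of
   [Y], and it may be refined along an epimorphism onto its source. *)
Lemma epi_cover X Y T (e : Hom X Y) (y : Hom T Y) :
  epi e -> exists T' (c : Hom T' T) (x : Hom T' X), epi c /\ e \oc x = y \oc c.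
Proof.
move=> ee; have [W [p [q [[eq _ _] qe]]]] := pullback_ex e y.
by exists W, q, p; split=> //; exact: qe.
Qed.

Lemma mono_of_comp_epi X Y Z (g : Hom Y Z) (f : Hom X Y) :
  mono (g \oc f) -> epi f -> mono g.
Proof.
move=> gfm fe; apply: mono_zero => T y gy.
have [T' [c [x [ce fx]]]] := epi_cover y fe.
have x0 : x = 0 by apply: (mono_eq0 gfm); rewrite -comp_assoc fx comp_assoc gy comp0l.
by apply: (epi_eq0 ce); rewrite -fx x0 comp0r.
Qed.

(** Exactness in terms of generalized elements, assuming only a cokernel: this is how the right
    exactness of [nu] enters the chases below. *)
Lemma cokernel_cover X Y Z T (f : Hom X Y) (g : Hom Y Z) (y : Hom T Y) :
  is_cokernel f g -> g \oc y = 0 ->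
  exists T' (c : Hom T' T) (x : Hom T' X), epi c /\ f \oc x = y \oc c.
Proof.
move=> cg gy; have [I [e [m [ee mm me]]]] := image_factorization f.
have cm : is_cokernel m g.
  apply: cokernelI; [|exact: cokernel_epi cg|].
    by apply: (epi_eq0 ee); rewrite -comp_assoc me cg.1.
  by move=> S h hm; apply: (cokernel_desc cg); rewrite -me comp_assoc hm comp0l.
have [y' my'] := kernel_lift (kernel_of_cokernel mm cm) gy.
have [T' [c [x [ce ex]]]] := epi_cover y' ee.
by exists T', c, x; split=> //; rewrite -me -my' -!comp_assoc ex.
Qed.

(* Five lemma, for an isomorphism in the middle. *)
Lemma map_short_exact_mono K Y X K' Y' X' (i : Hom K Y) (p : Hom Y X)
    (i' : Hom K' Y') (p' : Hom Y' X') (a : Hom K K') (b : Hom Y Y')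
    (c : Hom X X') :
  short_exact i p -> short_exact i' p' ->
  b \oc i = i' \oc a -> c \oc p = p' \oc b ->
  mono b -> epi a -> mono c.
Proof.
move=> ex ex' bi cp bm ae; apply: mono_zero => T x cx.
have [T1 [c1 [y [c1e py]]]] := epi_cover x (short_exact_epi ex).
have [|k ik] := kernel_lift (h := b \oc y) ex'.1.
  by rewrite comp_assoc -cp -comp_assoc py comp_assoc cx comp0l.
have [T2 [c2 [k0 [c2e ak]]]] := epi_cover k ae.
apply: (epi_eq0 (epi_comp c1e c2e)).
have -> : x \oc (c1 \oc c2) = p \oc (i \oc k0).
  rewrite comp_assoc -py -comp_assoc; congr (_ \oc _); apply: bm.
  by rewrite comp_assoc -ik -comp_assoc -ak !comp_assoc bi.
by rewrite comp_assoc (short_exact_comp0 ex) comp0l.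
Qed.

Lemma map_short_exact_epi Y X Y' X' (p : Hom Y X) (p' : Hom Y' X')
    (b : Hom Y Y') (c : Hom X X') :
  c \oc p = p' \oc b -> epi p' -> epi b -> epi c.
Proof.
move=> cp p'e be; apply: (@epi_of_comp _ _ _ _ _ p).
by rewrite cp; exact: epi_comp.
Qed.

Lemma exact_at_of_pair X Y Z (f : Hom X Y) (g : Hom Y Z) :
  exact_pair f g -> exact_at f g.
Proof.
move=> [gf fg]; have [L [c cf]] := cokernel_ex f.
have [I [k kk]] := kernel_ex c.
exists I, k; split; first by exists L, c.
apply: kernelI (kernel_mono kk) _.
  by have [g' <-] := cokernel_desc cf gf; rewrite -comp_assoc kk.1 comp0r.
by move=> T h gh; apply: (kernel_lift kk); exact: fg gh cf.1.
Qed.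

(** Used to turn a Gorenstein injective, defined as a kernel, into a quotient of the preceding term
    of its complex. *)
Lemma exact_at_epi K X Y Z (f : Hom X Y) (g : Hom Y Z) (k : Hom K Y) :
  exact_at f g -> is_kernel g k -> exists e, epi e /\ k \oc e = f.
Proof.
move=> [I [i [[L [c [cf ki]]] kgi]]] kk.
have [e' ie'] := kernel_lift ki cf.1.
have [|e ke] := kernel_lift (h := f) kk.
  by rewrite -ie' comp_assoc kgi.1 comp0l.
have [j ij] := kernel_lift kgi kk.1.
have [|T [q [x [qe fx]]]] := cokernel_cover (y := k) cf.
  by rewrite -ij comp_assoc ki.1 comp0l.
exists e; split=> //; apply: (@epi_of_comp _ _ _ _ _ x).
suff -> : e \oc x = q by [].
by apply: (kernel_mono kk); rewrite comp_assoc ke.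
Qed.

Lemma exact_pair_of_homology X Y Z (f : Hom X Y) (g : Hom Y Z) :
  g \oc f = 0 -> (forall H, is_homology f g H -> is_zero H) -> exact_pair f g.
Proof.
move=> gf hom0; split=> // K L k c gk cf.
have [I [j kj]] := kernel_ex g; have [f' jf'] := kernel_lift kj gf.
have [H [q cq]] := cokernel_ex f'.
have /is_zero_idm id0 : is_zero H by apply: hom0; exists I, j, f', q.
have [k' jk'] := kernel_lift kj gk.
have [|v vq] := cokernel_desc (h := c \oc j) cq.
  by rewrite -comp_assoc jf'.
by rewrite -jk' comp_assoc -vq -[q]comp_idl id0 !(comp0l, comp0r).
Qed.

Lemma short_exact_chain X Y Z W V (e : Hom X Y) (m : Hom Y Z) (e' : Hom Z W)
    (m' : Hom W V) :
  epi e -> short_exact m e' -> mono m' -> exact_pair (m \oc e) (m' \oc e').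
Proof.
move=> ee ex mm'; split.
  by rewrite -comp_assoc (comp_assoc e') (short_exact_comp0 ex) comp0l comp0r.
move=> K L k c; rewrite -comp_assoc => /(mono_eq0 mm') e'k.
rewrite comp_assoc => /(epi_eq0 ee) cm.
by have [u <-] := kernel_lift ex.1 e'k; rewrite comp_assoc cm comp0l.
Qed.

End Abelian.

Lemma pushout_short_exact (C : preadditive) (abC : abelian C) (K K' Y X : C)
    (i : Hom K Y) (p : Hom Y X) (h : Hom K K') :
  short_exact i p ->
  exists (Y' : C) (i' : Hom K' Y') (p' : Hom Y' X) (h' : Hom Y Y'),
    [/\ short_exact i' p', p' \oc h' = p & h' \oc i = i' \oc h].
Proof.
move=> /op_short_exact ex.
have [Y' [p' [i' [h' [ex' hp [com _ _] _]]]]] :=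
  @pullback_short_exact (op C) (op_abelian abC) _ _ _ _ _ _ h ex.
by exists Y', i', p', h'; split=> //; exact: short_exact_op.
Qed.

Section AdditiveFunctors.
Variables C D : preadditive.

Lemma fmap0 (F : functor C D) (X Y : C) : fmap F (0 : Hom X Y) = 0.
Proof. by apply: (addrI (fmap F 0)); rewrite -fmap_add !addr0. Qed.

Lemma fmap_iso (F : functor C D) (X Y : C) (f : Hom X Y) :
  is_iso f -> is_iso (fmap F f).
Proof.
by move=> [g [gf fg]]; exists (fmap F g); rewrite -!fmap_comp gf fg !fmap_id.
Qed.

Lemma fmap_biproduct (F : functor C D) (X Y Z : C) :
  is_biproduct X Y Z -> is_biproduct (F X) (F Y) (F Z).
Proof.
move=> [iX [iY [pX [pY [a b c d e]]]]].
exists (fmap F iX), (fmap F iY), (fmap F pX), (fmap F pY).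
by rewrite -!fmap_comp -fmap_add a b c d e !fmap_id !fmap0; split.
Qed.

End AdditiveFunctors.

Section LeftAdjoint.
Variables (C D : preadditive) (F : functor C D) (G : functor D C).
Variable adj : adjunction F G.

Lemma transpose_inj (X : C) (Y : D) (f g : Hom (F X) Y) :
  fmap G f \oc adj_unit adj X = fmap G g \oc adj_unit adj X -> f = g.
Proof.
move=> fg; have tr (h : Hom (F X) Y) :
    adj_counit adj Y \oc fmap F (fmap G h \oc adj_unit adj X) = h.
  rewrite fmap_comp comp_assoc counit_natural -comp_assoc triangle_left.
  exact: comp_idr.
by rewrite -[f]tr -[g]tr fg.
Qed.

Lemma transpose_surj (X : C) (Y : D) (h : Hom X (G Y)) :
  exists f : Hom (F X) Y, fmap G f \oc adj_unit adj X = h.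
Proof.
exists (adj_counit adj Y \oc fmap F h).
by rewrite fmap_comp -comp_assoc -unit_natural comp_assoc triangle_right comp_idl.
Qed.

Lemma left_adjoint_cokernel (X Y Z : C) (f : Hom X Y) (g : Hom Y Z) :
  is_cokernel f g -> is_cokernel (fmap F f) (fmap F g).
Proof.
move=> cg; apply: cokernelI; first by rewrite -fmap_comp cg.1 fmap0.
  apply: epi_zero => T h hg; apply: transpose_inj.
  rewrite fmap0 comp0l; apply: (epi_eq0 (cokernel_epi cg)).
  by rewrite -comp_assoc unit_natural comp_assoc -fmap_comp hg fmap0 comp0l.
move=> T h hf.
have [|u ug] := cokernel_desc (h := fmap G h \oc adj_unit adj Y) cg.
  by rewrite -comp_assoc unit_natural comp_assoc -fmap_comp hf fmap0 comp0l.
have [v vu] := transpose_surj u; exists v; apply: transpose_inj.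
by rewrite -ug -vu fmap_comp -!comp_assoc -unit_natural.
Qed.

Lemma left_adjoint_epi (X Y : C) (f : Hom X Y) : epi f -> epi (fmap F f).
Proof.
move=> fe; apply: epi_zero => T h hf; apply: transpose_inj.
rewrite fmap0 comp0l; apply: (epi_eq0 fe).
by rewrite -comp_assoc unit_natural comp_assoc -fmap_comp hf fmap0 comp0l.
Qed.

End LeftAdjoint.

Section RightAdjoint.
Variables (C D : preadditive) (F : functor C D) (G : functor D C).
Variable adj : adjunction F G.

Lemma right_adjoint_kernel (X Y Z : D) (f : Hom X Y) (g : Hom Y Z) :
  is_kernel g f -> is_kernel (fmap G g) (fmap G f).
Proof. exact: (left_adjoint_cokernel (op_adjunction adj)). Qed.

Lemma right_adjoint_mono (X Y : D) (f : Hom X Y) : mono f -> mono (fmap G f).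
Proof. exact: (left_adjoint_epi (op_adjunction adj)). Qed.

End RightAdjoint.

Lemma unit_iso_retract (C D : preadditive) (F : functor C D) (G : functor D C)
    (adj : adjunction F G) (X Y : C) (i : Hom X Y) (p : Hom Y X) :
  p \oc i = idm X -> is_iso (adj_unit adj Y) -> is_iso (adj_unit adj X).
Proof.
move=> pi1 [s [st ts]]; exists (p \oc s \oc fmap G (fmap F i)); split.
  rewrite -comp_assoc -unit_natural -comp_assoc (comp_assoc s) st comp_idl.
  exact: pi1.
rewrite !comp_assoc unit_natural -(comp_assoc _ (adj_unit adj Y)) ts comp_idr.
by rewrite -!fmap_comp pi1 !fmap_id.
Qed.

Lemma counit_iso_retract (C D : preadditive) (F : functor C D) (G : functor D C)
    (adj : adjunction F G) (X Y : D) (i : Hom X Y) (p : Hom Y X) :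
  p \oc i = idm X -> is_iso (adj_counit adj Y) -> is_iso (adj_counit adj X).
Proof.
move=> pi1 /op_is_iso iY; apply: is_iso_op.
exact: (unit_iso_retract (adj := op_adjunction adj) (i := p) (p := i)).
Qed.

(** [G] makes the counit a split epimorphism by a triangle identity, and a faithful functor reflects
    epimorphisms. *)
Lemma faithful_counit_epi (C D : preadditive) (F : functor C D)
    (G : functor D C) (adj : adjunction F G) (Y : D) :
  faithful G -> epi (adj_counit adj Y).
Proof.
move=> faithG Z g h gh; apply: faithG.
by rewrite -[LHS]comp_idr -[RHS]comp_idr -(triangle_right adj Y) !comp_assoc
  -!fmap_comp gh.
Qed.

(* [Q] is a retract of [F X], whose counit is split by [F] of a unit. *)
Lemma counit_split (C D : preadditive) (F : functor C D) (G : functor D C)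
    (adj : adjunction F G) (X : C) (Q : D) (i : Hom Q (F X)) (p : Hom (F X) Q) :
  p \oc i = idm Q -> exists s, adj_counit adj Q \oc s = idm Q.
Proof.
move=> pi1; exists (fmap F (fmap G p) \oc fmap F (adj_unit adj X) \oc i).
by rewrite !comp_assoc counit_natural -(comp_assoc p) triangle_left comp_idr.
Qed.

(** * Vanishing of the first derived functor *)

Definition preserves_cokernels (A B : preadditive) (F : functor A B) : Prop :=
  forall (X Y Z : A) (f : Hom X Y) (g : Hom Y Z),
    is_cokernel f g -> is_cokernel (fmap F f) (fmap F g).

Section Acyclic.
Variables (A B : preadditive).
Hypotheses (abA : abelian A) (abB : abelian B).
Variable nu : functor A B.
Hypothesis nu_cokernel : preserves_cokernels nu.

(* For right exact [nu] this says that the first left derived functor of [nu]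
   vanishes at [X]. *)
Definition acyclic (X : A) : Prop :=
  forall (K Y : A) (i : Hom K Y) (p : Hom Y X), short_exact i p ->
    mono (fmap nu i).

Lemma acyclic_short_exact (K Y X : A) (i : Hom K Y) (p : Hom Y X) :
  acyclic X -> short_exact i p -> short_exact (fmap nu i) (fmap nu p).
Proof.
move=> acX ex; have cnu := nu_cokernel ex.2.
by split=> //; apply: kernel_of_cokernel cnu => //; exact: acX ex.
Qed.

(** One presentation with acyclic middle term suffices, since the kernel of [fmap nu i] is then L_1
    nu (X). Another sequence ending in [X] is compared through the pullback [W], which contains both
    [K] and [Z]: an element killed by [fmap nu j] comes from [nu Z] after refinement, and there [mi]
    kills it. *)
Lemma acyclic_of_presentation (Z U X : A) (i : Hom Z U) (p : Hom U X) :
  short_exact i p -> acyclic U -> mono (fmap nu i) -> acyclic X.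
Proof.
move=> ex acU mi K Y j q ex'.
have [W [j' [q' [h [exW hj pbW _]]]]] := pullback_short_exact abA p ex'.
have [i' [hi ki']] := pullback_kernel (pullback_sym pbW) ex.1.
have he : epi h.
  have [V [r [h2 [[c2 _ _] h2e]]]] := pullback_ex abA p q.
  have [_ lift _] := pbW.
  have [t [ht _]] := lift _ _ _ (esym c2).
  by apply: (@epi_of_comp _ _ _ _ _ t); rewrite ht; exact/h2e/(short_exact_epi ex).
have ch := nu_cokernel (cokernel_of_kernel abA he ki').
have mj' := acU _ _ _ _ exW.
apply: mono_zero => T w jw.
have [|T' [c [z [ce iz]]]] := cokernel_cover abB (y := fmap nu j' \oc w) ch.
  by rewrite comp_assoc -fmap_comp hj.
have z0 : z = 0.
  apply: (mono_eq0 mi); rewrite -hi fmap_comp -comp_assoc iz !comp_assoc.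
  by rewrite -fmap_comp (short_exact_comp0 exW) fmap0 !comp0l.
apply: (mono_eq0 mj'); apply: (epi_eq0 ce).
by rewrite -iz z0 comp0r.
Qed.

Lemma nu_epi (X Y : A) (f : Hom X Y) : epi f -> epi (fmap nu f).
Proof.
move=> fe; have [K [k [_ ck]]] := epi_short_exact abA fe.
exact: cokernel_epi (nu_cokernel ck).
Qed.

Section Comonad.
Variables (T : functor A A) (eps : forall X, Hom (T X) X).
Hypothesis T_cokernel : preserves_cokernels T.
Hypothesis nuT_mono : forall (X Y : A) (f : Hom X Y),
  mono f -> mono (fmap nu (fmap T f)).
Hypothesis eps_natural : forall (X Y : A) (f : Hom X Y),
  eps Y \oc fmap T f = f \oc eps X.
Hypothesis eps_epi : forall X, epi (eps X).

(* A section of [eps Q] exhibits a short exact sequence ending in [Q] as a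
   quotient of a pullback of its image under [T], on which [nu] is exact. *)
Lemma split_counit_acyclic (Q : A) (s : Hom Q (T Q)) :
  eps Q \oc s = idm Q -> acyclic Q.
Proof.
move=> es K Y i p ex; have cT := T_cokernel ex.2.
have pe := short_exact_epi ex.
(* [T] is only right exact, so [T K] need not be the kernel of [fmap T p]; it merely maps onto that
   kernel [K1], by [t]. *)
have [K1 [k exT]] := epi_short_exact abA (cokernel_epi cT).
have [kap ikap] : exists kap, i \oc kap = eps Y \oc k.
  apply: (kernel_lift ex.1).
  by rewrite comp_assoc -eps_natural -comp_assoc exT.1.1 comp0r.
have [t kt] : exists t, k \oc t = fmap T i.
  by apply: (kernel_lift exT.1); rewrite -fmap_comp ex.1.1 fmap0.
have te : epi t.
  have [T' [c [x [ce ix]]]] := cokernel_cover abA cT exT.1.1.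
  apply: (@epi_of_comp _ _ _ _ _ x); suff -> : t \oc x = c by [].
  by apply: (short_exact_mono exT); rewrite comp_assoc kt ix.
have kape : epi kap.
  apply: (@epi_of_comp _ _ _ _ _ t).
  suff -> : kap \oc t = eps K by exact: eps_epi.
  by apply: (short_exact_mono ex); rewrite comp_assoc ikap -comp_assoc kt eps_natural.
(* Precomposed with the epimorphism [fmap nu t], this map is [nu T] of a mono. *)
have mk : mono (fmap nu k).
  apply: mono_of_comp_epi (nu_epi te) => //.
  by rewrite -fmap_comp kt; exact: nuT_mono (short_exact_mono ex).
have [W [k' [q [h [exW hk [eq lift uniq] _]]]]] := pullback_short_exact abA s exT.
(* [w] maps the pulled back sequence onto the given one, as the identity on [Q] and as [kap] on the
   left; hence its kernel is that of [kap]. *)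
pose w := eps Y \oc h.
have pw : p \oc w = q.
  by rewrite comp_assoc -eps_natural -comp_assoc eq comp_assoc es comp_idl.
have wk : w \oc k' = i \oc kap by rewrite -comp_assoc hk.
have mk' : mono (fmap nu k').
  by apply: (@mono_of_comp _ _ _ _ (fmap nu h)); rewrite -fmap_comp hk.
have [R [rho kr]] := kernel_ex abA kap.
have kw : is_kernel w (k' \oc rho).
  apply: kernelI.
  - by rewrite comp_assoc wk -comp_assoc kr.1 comp0r.
  - exact: mono_comp (short_exact_mono exW) (kernel_mono kr).
  move=> S z wz; have [|u ku] := kernel_lift (h := z) exW.1.
    by rewrite -pw -comp_assoc wz comp0r.
  have [|v rv] := kernel_lift (h := u) kr.
    apply: (mono_eq0 (short_exact_mono ex)).
    by rewrite comp_assoc -wk -comp_assoc ku wz.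
  by exists v; rewrite -comp_assoc rv.
have we : epi w.
  apply: epi_zero => S g gw.
  have [|g' g'p] := cokernel_desc (h := g) ex.2.
    by apply: (epi_eq0 kape); rewrite -comp_assoc -wk comp_assoc gw comp0l.
  rewrite -g'p; suff -> : g' = 0 by rewrite comp0l.
  by apply: (epi_eq0 (short_exact_epi exW)); rewrite -pw comp_assoc g'p gw.
have cw := nu_cokernel (cokernel_of_kernel abA we kw).
apply: mono_zero => S x ix.
(* Lift [x] along [kap] to [y]. The image of [y] in [nu W] dies in [nu Y], so it comes from [nu R];
   by [mk'] already [y] does, and [kap] kills [R]. *)
have [S1 [c1 [y [c1e xy]]]] := epi_cover abB x (nu_epi kape).
have [|S2 [c2 [r [c2e ry]]]] := cokernel_cover abB (y := fmap nu k' \oc y) cw.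
  by rewrite comp_assoc -fmap_comp wk fmap_comp -comp_assoc xy comp_assoc ix comp0l.
have yr : fmap nu rho \oc r = y \oc c2.
  by apply: mk'; rewrite comp_assoc -fmap_comp ry comp_assoc.
apply: (epi_eq0 c1e); apply: (epi_eq0 c2e).
by rewrite -xy -comp_assoc -yr comp_assoc -fmap_comp kr.1 fmap0 comp0l.
Qed.
End Comonad.

Variable P : A -> Prop.
Hypothesis P_acyclic : forall Q, P Q -> acyclic Q.
Hypothesis P_enough : forall X, exists Q (q : Hom Q X), P Q /\ epi q.

(* [nu] has no second derived functor. *)
Hypothesis second_vanish : forall (X : A) (Q : nat -> A)
    (d : forall i, Hom (Q i.+1) (Q i)) (e : Hom (Q 0%N) X),
  (forall i, P (Q i)) -> epi e -> exact_pair (d 0%N) e ->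
  (forall i, exact_pair (d i.+1) (d i)) ->
  exact_pair (fmap nu (d 2%N)) (fmap nu (d 1%N)).

(** Choosing a cover of every object at once makes the syzygy a function [K], whose iterates give a
    resolution. *)
Lemma cover_choice : exists (K Q : A -> A) (m : forall X, Hom (K X) (Q X))
    (e : forall X, Hom (Q X) X), forall X, P (Q X) /\ short_exact (m X) (e X).
Proof.
have ex X : exists s : {K : A & {Q : A & (Hom K Q * Hom Q X)%type}},
    P (projT1 (projT2 s)) /\
    short_exact (projT2 (projT2 s)).1 (projT2 (projT2 s)).2.
  have [Q [q [PQ qe]]] := P_enough X.
  have [K [k kq]] := epi_short_exact abA qe.
  by exists (existT _ K (existT _ Q (k, q))).
pose s X := constructive_indefinite_description _ (ex X).
exists (fun X => projT1 (sval (s X))), (fun X => projT1 (projT2 (sval (s X)))).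
exists (fun X => (projT2 (projT2 (sval (s X)))).1).
exists (fun X => (projT2 (projT2 (sval (s X)))).2).
by move=> X; exact: (svalP (s X)).
Qed.

(* Splice [X -> Q] with a resolution of [X] into a resolution of the cokernel;
   the second homology of its image under [nu] is the obstruction. *)
Lemma subobject_acyclic (X Q : A) (m0 : Hom X Q) : P Q -> mono m0 -> acyclic X.
Proof.
move=> PQ m0m; have [Z [e0 ex0]] := mono_short_exact abA m0m.
have [K [R [m [e Rme]]]] := cover_choice.
have exK Y := (Rme Y).2.
(* [Y i] is the [i]-th syzygy of [X]. Its cover sits in degree [i + 1], since degree 0 of the
   resolution of [Z] is occupied by [Q]. *)
pose Y i := iter i K X.
pose Q' i := if i is j.+1 then R (Y j) else Q.
pose d i : Hom (Q' i.+1) (Q' i) :=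
  match i with
  | 0%N => m0 \oc e X
  | j.+1 => m (Y j) \oc e (Y j.+1)
  end.
have [_ H2] : exact_pair (fmap nu (d 2%N)) (fmap nu (d 1%N)).
  apply: (second_vanish (e := e0)).
  - by case=> [|i] //=; exact: (Rme _).1.
  - exact: short_exact_epi ex0.
  - rewrite -[e0]comp_idl.
    exact: short_exact_chain (short_exact_epi (exK X)) ex0 (@mono_idm _ _).
  case=> [|i]; apply: short_exact_chain => //; try exact: short_exact_epi (exK _).
  - exact: short_exact_mono (exK _).
(* The differential [d 1] is [m X] after the cover of [K X], and that cover kills [d 2]. A lift of
   [z] to the cover is thus a cycle, and exactness in degree 2 makes the cover kill it. *)
have mK : mono (fmap nu (m X)).
  apply: mono_zero => T z mz.
  have [T' [c [y [ce yz]]]] := epi_cover abB z (nu_epi (short_exact_epi (exK (K X)))).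
  apply: (epi_eq0 ce); rewrite -yz; apply: H2; rewrite /= fmap_comp.
    by rewrite -comp_assoc yz comp_assoc mz comp0l.
  by rewrite -!fmap_comp comp_assoc (short_exact_comp0 (exK _)) comp0l fmap0.
by apply: acyclic_of_presentation (exK X) _ mK; exact: P_acyclic (Rme X).1.
Qed.

End Acyclic.

(** * Subobjects of relative projectives *)

Definition coacyclic (A B : preadditive) (F : functor A B) (X : A) : Prop :=
  forall (Y K : A) (i : Hom X Y) (p : Hom Y K), short_exact i p ->
    epi (fmap F p).

Definition subobject_of (A : preadditive) (P : A -> Prop) (X : A) : Prop :=
  exists (Q : A) (m : Hom X Q), P Q /\ mono m.

Definition quotient_of (A : preadditive) (I : A -> Prop) (X : A) : Prop :=
  exists (J : A) (q : Hom J X), I J /\ epi q.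

(* What is used of a Nakayama functor of Iwanaga-Gorenstein dimension at most
   one, with [P] and [I] the relative projectives and injectives.  Passing to
   opposite categories exchanges [nu] with [nui] and [P] with [I]. *)
Record nakayama_dim1 (A : preadditive) (nu nui : functor A A)
    (adj : adjunction nu nui) (P I : A -> Prop) : Prop := NakayamaDim1 {
  dim1_abelian : abelian A;
  dim1_cover : forall X, quotient_of P X;
  dim1_embed : forall X, subobject_of I X;
  dim1_nu : forall Q, P Q -> I (nu Q);
  dim1_nui : forall J, I J -> P (nui J);
  dim1_unit : forall Q, P Q -> is_iso (adj_unit adj Q);
  dim1_counit : forall J, I J -> is_iso (adj_counit adj J);
  dim1_acyclic : forall X, subobject_of P X -> acyclic nu X;
  dim1_coacyclic : forall X, quotient_of I X -> coacyclic nui X }.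

Lemma op_nakayama_dim1 (A : preadditive) (nu nui : functor A A)
    (adj : adjunction nu nui) (P I : A -> Prop) :
  nakayama_dim1 adj P I ->
  @nakayama_dim1 (op A) (op_functor nui) (op_functor nu) (op_adjunction adj) I P.
Proof.
case=> abA cov emb nuP nuiI un coun ac coac; split=> //.
- exact: op_abelian.
- by move=> J /coun /op_is_iso.
- by move=> Q /un /op_is_iso.
- by move=> X qX K Y i p /short_exact_op; exact: coac.
- by move=> X sX Y K i p /short_exact_op; exact: ac.
Qed.

Section Dim1.
Variables (A : preadditive) (nu nui : functor A A) (adj : adjunction nu nui).
Variables (P I : A -> Prop).
Hypothesis dim1 : nakayama_dim1 adj P I.

Let abA := dim1_abelian dim1.

Lemma P_subobject (Q : A) : P Q -> subobject_of P Q.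
Proof. by move=> PQ; exists Q, (idm Q); split=> //; exact: mono_idm. Qed.

Lemma subobject_of_mono (X Y : A) (m : Hom X Y) :
  mono m -> subobject_of P Y -> subobject_of P X.
Proof.
by move=> mm [Q [m' [PQ mm']]]; exists Q, (m' \oc m); split=> //; exact: mono_comp.
Qed.

(** Holds for every [B], as [nui] preserves an embedding into a relative injective. This supplies
    all new members of the class below. *)
Lemma nui_subobject (B : A) : subobject_of P (nui B).
Proof.
have [J [j [IJ jm]]] := dim1_embed dim1 B.
exists (nui J), (fmap nui j); split; first exact: (dim1_nui dim1).
exact: (right_adjoint_mono adj).
Qed.

Lemma nu_quotient (B : A) : quotient_of I (nu B).
Proof.
have [Q [q [PQ qe]]] := dim1_cover dim1 B.
exists (nu Q), (fmap nu q); split; first exact: (dim1_nu dim1).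
exact: (left_adjoint_epi adj).
Qed.

Lemma nu_short_exact (K Y X : A) (i : Hom K Y) (p : Hom Y X) :
  subobject_of P X -> short_exact i p -> short_exact (fmap nu i) (fmap nu p).
Proof.
move=> sX; apply: acyclic_short_exact => //; last exact: (dim1_acyclic dim1).
move=> ? ? ? ? ?; exact: (left_adjoint_cokernel adj).
Qed.

Lemma nui_short_exact (X Y K : A) (i : Hom X Y) (p : Hom Y K) :
  quotient_of I X -> short_exact i p ->
  short_exact (fmap nui i) (fmap nui p).
Proof.
move=> qX ex; have pe := dim1_coacyclic dim1 qX ex.
have ki := right_adjoint_kernel adj ex.1.
by split=> //; exact: cokernel_of_kernel.
Qed.

Lemma nui_nu_short_exact (K Y X : A) (i : Hom K Y) (p : Hom Y X) :
  subobject_of P X -> short_exact i p ->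
  short_exact (fmap nui (fmap nu i)) (fmap nui (fmap nu p)).
Proof.
by move=> sX ex; apply: nui_short_exact (nu_quotient K) (nu_short_exact sX ex).
Qed.

(** Five lemma along a cover, where the unit is invertible. Epimorphy descends directly to the
    quotient; applied to the kernel of the cover, again a subobject of a relative projective, it
    yields monomorphy. *)
Lemma subobject_unit_iso (X : A) :
  subobject_of P X -> is_iso (adj_unit adj X).
Proof.
have cover Z : subobject_of P Z -> exists (K Q : A) (k : Hom K Q) (q : Hom Q Z),
    [/\ subobject_of P K, P Q, short_exact k q
      & short_exact (fmap nui (fmap nu k)) (fmap nui (fmap nu q))].
  move=> sZ; have [Q [q [PQ qe]]] := dim1_cover dim1 Z.
  have [K [k ex]] := epi_short_exact abA qe.
  exists K, Q, k, q; split=> //; last exact: nui_nu_short_exact.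
  exact: subobject_of_mono (short_exact_mono ex) (P_subobject PQ).
have unit_epi Z : subobject_of P Z -> epi (adj_unit adj Z).
  move=> /cover [K [Q [k [q [_ PQ ex ex']]]]].
  apply: map_short_exact_epi (unit_natural adj q) (short_exact_epi ex') _.
  exact: iso_epi (dim1_unit dim1 PQ).
move=> sX; apply: mono_epi_iso => //; last exact: unit_epi.
have [K [Q [k [q [sK PQ ex ex']]]]] := cover X sX.
apply: map_short_exact_mono ex ex' (unit_natural adj k) (unit_natural adj q) _ _ => //.
  exact: iso_mono (dim1_unit dim1 PQ).
exact: unit_epi.
Qed.

(** No embedding is assembled from those of [L] and [N]: the unit of [M] lands in the class, and it
    is mono by the four lemma because [nui nu] keeps the row exact. *)
Lemma subobject_extension_closed : extension_closed (subobject_of P).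
Proof.
move=> L M N f g ex sL sN.
apply: (subobject_of_mono (m := adj_unit adj M)) (nui_subobject _).
have ex' := nui_nu_short_exact sN ex.
apply: mono_zero => T z uz.
have [|w fw] := kernel_lift (h := z) ex.1.
  apply: (mono_eq0 (iso_mono (subobject_unit_iso sN))).
  by rewrite comp_assoc unit_natural -comp_assoc uz comp0r.
rewrite -fw; suff -> : w = 0 by rewrite comp0r.
apply: (mono_eq0 (iso_mono (subobject_unit_iso sL))).
apply: (mono_eq0 (short_exact_mono ex')).
by rewrite comp_assoc -unit_natural -comp_assoc fw.
Qed.

Lemma subobject_approximation (M : A) :
  exists (R : A) (r : Hom M R), subobject_of P R /\
    forall (Z : A) (h : Hom M Z), subobject_of P Z -> exists h', h' \oc r = h.
Proof.
exists (nui (nu M)), (adj_unit adj M); split; first exact: nui_subobject.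
move=> Z h /subobject_unit_iso [u [uu _]].
exists (u \oc fmap nui (fmap nu h)).
by rewrite -comp_assoc -unit_natural comp_assoc uu comp_idl.
Qed.

Lemma subobject_left_step (X : A) : subobject_of P X ->
  exists (Y Q : A) (i : Hom Y Q) (p : Hom Q X),
    [/\ P Q, subobject_of P Y, short_exact i p
      & short_exact (fmap nu i) (fmap nu p)].
Proof.
move=> sX; have [Q [q [PQ qe]]] := dim1_cover dim1 X.
have [K [k ex]] := epi_short_exact abA qe.
exists K, Q, k, q; split=> //; last exact: nu_short_exact.
exact: subobject_of_mono (short_exact_mono ex) (P_subobject PQ).
Qed.

(** A given embedding into a relative projective may have a cokernel outside the class. Embedding
    [nu X] into a relative injective and applying [nui] gives the cokernel [nui B], which is always
    inside. *)
Lemma subobject_right_step (X : A) : subobject_of P X ->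
  exists (Y Q : A) (i : Hom X Q) (p : Hom Q Y),
    [/\ P Q, subobject_of P Y, short_exact i p
      & short_exact (fmap nu i) (fmap nu p)].
Proof.
move=> sX; have [J [j [IJ jm]]] := dim1_embed dim1 (nu X).
have [B [b ex]] := mono_short_exact abA jm.
have exi := nui_short_exact (nu_quotient X) ex.
have exX := short_exact_iso_l (subobject_unit_iso sX) exi.
have sB := nui_subobject B.
exists (nui B), (nui J); eexists; eexists; split; [|exact: sB|exact: exX|].
  exact: (dim1_nui dim1).
exact: nu_short_exact.
Qed.

End Dim1.

Lemma splice_complex (A B : preadditive) (abA : abelian A) (abB : abelian B)
    (F : functor A B) (E P : A -> Prop) :
  (forall X, E X -> exists (Y Q : A) (i : Hom Y Q) (p : Hom Q X),
     [/\ P Q, E Y, short_exact i p & short_exact (fmap F i) (fmap F p)]) ->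
  (forall X, E X -> exists (Y Q : A) (i : Hom X Q) (p : Hom Q Y),
     [/\ P Q, E Y, short_exact i p & short_exact (fmap F i) (fmap F p)]) ->
  forall X, E X ->
  exists (Q : int -> A) (d : forall i, Hom (Q i) (Q (i - 1))),
    [/\ forall i, P (Q i), exact_complex d,
        exact_complex (fun i => fmap F (d i))
      & exists k : Hom X (Q 0), is_kernel (d 0) k].
Proof.
move=> lstep rstep X EX.
(* The middle terms stay existential here, so that only the cycles are iterated; the terms of the
   complex are chosen afterwards, degree by degree. *)
pose link X Y := exists (Q : A) (i : Hom X Q) (p : Hom Q Y),
  [/\ P Q, short_exact i p & short_exact (fmap F i) (fmap F p)].
have nextP (Z : {Z | E Z}) : exists Y : {Y | E Y}, link (sval Z) (sval Y).
  have [Y [Q [i [p [PQ EY e1 e2]]]]] := rstep _ (svalP Z).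
  by exists (exist _ Y EY), Q, i, p.
have prevP (Z : {Z | E Z}) : exists Y : {Y | E Y}, link (sval Y) (sval Z).
  have [Y [Q [i [p [PQ EY e1 e2]]]]] := lstep _ (svalP Z).
  by exists (exist _ Y EY), Q, i, p.
pose next Z := sval (constructive_indefinite_description _ (nextP Z)).
pose prev Z := sval (constructive_indefinite_description _ (prevP Z)).
have nextE Z : link (sval Z) (sval (next Z))
  by exact: (svalP (constructive_indefinite_description _ (nextP Z))).
have prevE Z : link (sval (prev Z)) (sval Z)
  by exact: (svalP (constructive_indefinite_description _ (prevP Z))).
pose X0 : {Z | E Z} := exist _ X EX.
(* [Z n] is the kernel in degree [n]. Since [Negz k] is [- (k + 1)], it takes [k.+1] steps to the
   right. *)
pose Z (n : int) : A := sval (match n with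
  | Posz k => iter k prev X0
  | Negz k => iter k.+1 next X0
  end).
have linkZ n : link (Z n) (Z (n - 1)).
  case: n => [[|k]|k].
  - exact: nextE.
  - have -> : (Posz k.+1 - 1 = Posz k :> int)%R by rewrite intS addrC addKr.
    exact: prevE.
  - have -> : (Negz k - 1 = Negz k.+1 :> int)%R.
      by rewrite !NegzE -opprD -PoszD addn1.
    exact: nextE.
pose S n := {Q : A & (Hom (Z n) Q * Hom Q (Z (n - 1)))%type}.
have exS n : exists s : S n, [/\ P (projT1 s),
    short_exact (projT2 s).1 (projT2 s).2
    & short_exact (fmap F (projT2 s).1) (fmap F (projT2 s).2)].
  by have [Q [i [p [PQ e1 e2]]]] := linkZ n; exists (existT _ Q (i, p)).
pose s n := sval (constructive_indefinite_description _ (exS n)).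
have sE n : [/\ P (projT1 (s n)),
    short_exact (projT2 (s n)).1 (projT2 (s n)).2
    & short_exact (fmap F (projT2 (s n)).1) (fmap F (projT2 (s n)).2)].
  exact: svalP (constructive_indefinite_description _ (exS n)).
exists (fun n => projT1 (s n)).
exists (fun n => (projT2 (s (n - 1))).1 \oc (projT2 (s n)).2); split.
- by move=> n; have [] := sE n.
- move=> n; apply: exact_at_of_pair => //.
  have [_ e0 _] := sE n; have [_ e1 _] := sE (n - 1).
  have [_ e2 _] := sE (n - 1 - 1).
  exact: short_exact_chain (short_exact_epi e0) e1 (short_exact_mono e2).
- move=> n; apply: exact_at_of_pair => //.
  have [_ _ e0] := sE n; have [_ _ e1] := sE (n - 1).
  have [_ _ e2] := sE (n - 1 - 1); rewrite !fmap_comp.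
  exact: short_exact_chain (short_exact_epi e0) e1 (short_exact_mono e2).
have [_ e0 _] := sE 0; have [_ e1 _] := sE (0 - 1).
exists (projT2 (s 0)).1; apply: kernelI (short_exact_mono e0) _.
  by rewrite -comp_assoc (short_exact_comp0 e0) comp0r.
move=> T h; rewrite -comp_assoc => /(mono_eq0 (short_exact_mono e1)).
exact: kernel_lift e0.1.
Qed.

(** * Almost split sequences *)

Lemma local_End_sub (C : preadditive) (X : C) (t : Hom X X) :
  local_End X -> ~ is_iso t -> is_iso (idm X - t).
Proof.
move=> [_ loc] nt; apply: NNPP => nt'.
by apply: (loc _ _ nt nt'); rewrite addrC subrK; exists (idm X); rewrite comp_idl.
Qed.

Section AlmostSplit.
Variables (A : preadditive) (abA : abelian A) (E : A -> Prop).
Hypothesis E_ext : extension_closed E.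

(** Pull back along a non-split [h]. If the result does not split, [f] maps into it, inducing [t]
    from [N] to [Z]. As [h \oc t] is not invertible and [N] has local endomorphism ring,
    [idm N - h \oc t] is; but it lifts through [g], which would split. *)
Lemma almost_split_of_left (L M N : A) (f : Hom L M) (g : Hom M N) :
  exact_in E f g -> left_almost_split E f -> local_End N ->
  almost_split_sequence E f g.
Proof.
move=> exE [nsf lf] locN; split=> //.
have [EL EM EN ex] := exE; split.
  by move=> [s /(split_epi_retraction ex)].
move=> Z h EZ nsh.
have [U [j [q [h' [exU hj pb _]]]]] := pullback_short_exact abA h ex.
have EU : E U := E_ext exU EL EZ.
have [[r rj]|nsj] := classic (split_mono j).
  have [s qs] := split_mono_section exU rj.
  exists (h' \oc s); have [eq _ _] := pb.
  by rewrite comp_assoc eq -comp_assoc qs comp_idr.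
exfalso; have [v vf] := lf U j EU nsj.
have [|t tg] := cokernel_desc (h := q \oc v) ex.2.
  by rewrite -comp_assoc vf (short_exact_comp0 exU).
have [|w [w1 w2]] := local_End_sub (t := h \oc t) locN.
  by move=> [s [_ ts]]; apply: nsh; exists (t \oc s); rewrite comp_assoc.
have [|s sg] := cokernel_desc (h := idm M - h' \oc v) ex.2.
  by rewrite compBl comp_idl -comp_assoc vf hj subrr.
have gs : g \oc s = idm N - h \oc t.
  apply: (short_exact_epi ex); have [eq _ _] := pb.
  rewrite -comp_assoc sg compBr comp_idr comp_assoc eq compBl comp_idl.
  by rewrite -!comp_assoc tg.
apply: nsf; apply: (split_epi_retraction ex (s := s \oc w)).
by rewrite comp_assoc gs.
Qed.

(** An extension problem without solution becomes a non-split sequence by pushing out along [h];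
    extension-closure keeps the pushout in [E]. *)
Lemma nonsplit_of_not_injective (L : A) : E L -> ~ injective_in E L ->
  exists (X Y : A) (a : Hom L X) (b : Hom X Y),
    exact_in E a b /\ ~ split_mono a.
Proof.
move=> EL ninj; apply: NNPP => none; apply: ninj; split=> // L' M N f g.
move=> [EL' EM EN ex] h.
have [X [a [b [h' [exX _ hf]]]]] := pushout_short_exact abA h ex.
have [[r ra]|nsa] := classic (split_mono a).
  by exists (r \oc h'); rewrite -comp_assoc hf comp_assoc ra comp_idl.
by case: none; exists X, N, a, b; split=> //; split=> //; exact: E_ext exX EL EN.
Qed.

Hypothesis E_sub : forall (X Y : A) (m : Hom X Y), mono m -> E Y -> E X.
Hypothesis E_approx : forall M : A, exists (R : A) (r : Hom M R),
  E R /\ forall (Z : A) (h : Hom M Z), E Z -> exists h', h' \oc r = h.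

Lemma sub_indecomposable (L : A) :
  indecomposable E L -> indecomposable (whole A) L.
Proof.
move=> [EL nz ind]; split=> // Y Z _ _ b; apply: ind => //.
  by have [i [p pi1]] := biproduct_retract b; exact: E_sub (retract_mono pi1) EL.
have [i [p pi1]] := biproduct_retract (biproduct_swap b).
exact: E_sub (retract_mono pi1) EL.
Qed.

Lemma injective_in_whole (L : A) :
  E L -> injective_in (whole A) L -> injective_in E L.
Proof.
move=> EL [_ inj]; split=> // X Y Z f g [_ _ _ ex].
by apply: (inj X Y Z f g); split.
Qed.

Lemma krull_schmidt_sub : krull_schmidt (whole A) -> krull_schmidt E.
Proof.
move=> ks X EX; have [m [Y [locY [i [p [pi1 pi0 ip]]]]]] := ks X I.
exists m, Y; split; last by exists i, p.
move=> k; split; last exact: (locY k).2.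
exact: E_sub (retract_mono (pi1 k)) EX.
Qed.

(* If every restriction of [g] over a summand split, so would [g]. *)
Lemma nonsplit_summand (L M N : A) (f : Hom L M) (g : Hom M N) :
  krull_schmidt (whole A) -> short_exact f g -> ~ split_mono f ->
  exists (N' M' : A) (i : Hom N' N) (h : Hom M' M) (f' : Hom L M')
      (g' : Hom M' N'),
    [/\ local_End N', mono h, short_exact f' g', h \oc f' = f
      & ~ split_mono f'].
Proof.
move=> ks ex nsf; have [m [Y [locY [i [p [pi1 pi0 ip]]]]]] := ks N I.
apply: NNPP => none; apply: nsf.
have lift k : exists l : Hom (Y k) M, g \oc l = i k.
  have [M' [f' [g' [h [ex' hf pb _]]]]] := pullback_short_exact abA (i k) ex.
  have hm : mono h := pullback_mono pb (retract_mono (pi1 k)).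
  have [[r rf]|nsf'] := classic (split_mono f').
    have [s gs] := split_mono_section ex' rf; exists (h \oc s).
    by have [eq _ _] := pb; rewrite comp_assoc eq -comp_assoc gs comp_idr.
  case: none; exists (Y k), M', (i k), h, f', g'.
  by split=> //; exact: (locY k).2.
have [l gl] := fin_all_exists lift.
apply: (split_epi_retraction ex (s := \sum_(k < m) l k \oc p k)).
by rewrite comp_sumr -ip; apply: eq_bigr => k _; rewrite comp_assoc gl.
Qed.

Lemma sub_starting_almost_split :
  krull_schmidt (whole A) -> starting_almost_split (whole A) ->
  starting_almost_split E.
Proof.
move=> ks ass L indL ninj; have [EL _ _] := indL.
(* The non-split sequence in [E] obtained next serves twice: [r] need not be mono, yet [f1] is
   because [a] factors through it; and at the end its cokernel [Y] in [E] forces the cokernel [N]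
   into [E]. *)
have [|M [N0 [f0 [g0 [ex0 [nsf0 lf0] _]]]]] := ass L (sub_indecomposable indL).
  by move=> /(injective_in_whole EL).
have [X [Y [a [b [[_ EX EY exXY] nsa]]]]] := nonsplit_of_not_injective EL ninj.
have [R [r [ER appr]]] := E_approx M.
pose f1 := r \oc f0.
have lf1 Z (h : Hom L Z) : E Z -> ~ split_mono h -> exists h', h' \oc f1 = h.
  move=> EZ nsh; have [h1 h1f] := lf0 Z h I nsh.
  have [h2 h2r] := appr Z h1 EZ; exists h2.
  by rewrite comp_assoc h2r.
have nsf1 : ~ split_mono f1.
  by move=> [s sf]; apply: nsf0; exists (s \oc r); rewrite -comp_assoc.
have [u1 u1f] := lf1 X a EX nsa.
have f1m : mono f1.
  by apply: (@mono_of_comp _ _ _ _ u1); rewrite u1f; exact: short_exact_mono exXY.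
have [N1 [g1 ex1]] := mono_short_exact abA f1m.
have [N [M' [_ [h [f [g [locN hm ex hf nsf]]]]]]] := nonsplit_summand ks ex1 nsf1.
have EM' : E M' := E_sub hm ER.
have lf : left_almost_split E f.
  split=> // Z z EZ /(lf1 Z z EZ) [z' z'f]; exists (z' \oc h).
  by rewrite -comp_assoc hf.
exists M', N, f, g; apply: almost_split_of_left => //; split=> //.
(* The kernel [K] of the approximation of [N] is killed by every map into
   [E], so the sequence splits over [K], which embeds [K] into [M']. *)
have [R' [r' [ER' appr']]] := E_approx N.
have [I' [e [m [ee mm me]]]] := image_factorization abA r'.
have [K [k exK]] := epi_short_exact abA ee.
apply: (E_ext exK) (E_sub mm ER').
have [M2 [f2 [g2 [j [ex2 jf [eq _ _] _]]]]] := pullback_short_exact abA k ex.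
pose u := u1 \oc h.
have uf : u \oc f = a by rewrite -comp_assoc hf.
have [|w wg] := cokernel_desc (h := b \oc u) ex.2.
  by rewrite -comp_assoc uf (short_exact_comp0 exXY).
have wk : w \oc k = 0.
  have [w' <-] := appr' Y w EY.
  by rewrite -me -!comp_assoc (short_exact_comp0 exK) !comp0r.
have [|u2 au2] := kernel_lift (h := u \oc j) exXY.1.
  by rewrite comp_assoc -wg -comp_assoc eq comp_assoc wk comp0l.
have u2f : u2 \oc f2 = idm L.
  apply: (short_exact_mono exXY).
  by rewrite comp_assoc au2 -comp_assoc jf uf comp_idr.
have [s gs] := split_mono_section ex2 u2f.
apply: (E_sub (m := j \oc s)) EM'; apply: (@mono_of_comp _ _ _ _ g).
by rewrite comp_assoc eq -comp_assoc gs comp_idr; exact: short_exact_mono exK.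
Qed.

End AlmostSplit.

Lemma short_exact_iso_r (C : preadditive) (X Y Z Z' : C) (f : Hom X Y)
    (g : Hom Y Z) (e : Hom Z Z') :
  is_iso e -> short_exact f g -> short_exact f (e \oc g).
Proof.
move=> /op_is_iso ie /op_short_exact ex.
by apply: short_exact_op; exact: (@short_exact_iso_l (op C)).
Qed.

(** * Transport along an adjunction restricting to an exact equivalence *)

Section Equivalence.
Variables (A : preadditive) (F G : functor A A) (adj : adjunction F G).
Variables (E E' : A -> Prop).
Hypothesis FE : forall X, E X -> E' (F X).
Hypothesis GE : forall X, E' X -> E (G X).
Hypothesis unit_iso : forall X, E X -> is_iso (adj_unit adj X).
Hypothesis counit_iso : forall X, E' X -> is_iso (adj_counit adj X).
Hypothesis F_exact : forall (X Y Z : A) (f : Hom X Y) (g : Hom Y Z),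
  exact_in E f g -> short_exact (fmap F f) (fmap F g).
Hypothesis G_exact : forall (X Y Z : A) (f : Hom X Y) (g : Hom Y Z),
  exact_in E' f g -> short_exact (fmap G f) (fmap G g).

Lemma equivalence_zero (X : A) : E X -> is_zero (F X) -> is_zero X.
Proof.
move=> EX /is_zero_idm id0; apply/is_zero_idm.
apply: (iso_mono (unit_iso EX)).
by rewrite unit_natural fmap_id id0 fmap0 comp0l comp0r.
Qed.

Lemma equivalence_zero_inv (X : A) : E' X -> is_zero (G X) -> is_zero X.
Proof.
move=> EX /is_zero_idm id0; apply/is_zero_idm.
apply: (iso_epi (counit_iso EX)).
by rewrite -counit_natural fmap_id id0 fmap0 comp0l comp0r.
Qed.

Lemma equivalence_indecomposable (X : A) :
  indecomposable E X -> indecomposable E' (F X).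
Proof.
move=> [EX nz ind]; split=> [||Y Z EY EZ b]; first exact: FE.
  by move=> /(equivalence_zero EX).
have /(fmap_biproduct G) : is_biproduct Y Z (F X) by [].
move=> [iX [iY [pX [pY [b1 b2 b3 b4 b5]]]]].
have [v [vu uv]] := unit_iso EX.
have bX : is_biproduct (G Y) (G Z) X.
  exists (v \oc iX), (v \oc iY), (pX \oc adj_unit adj X), (pY \oc adj_unit adj X).
  have cancel (S T : A) (p : Hom (G (F X)) T) (i : Hom S (G (F X))) :
      p \oc adj_unit adj X \oc (v \oc i) = p \oc i.
    by rewrite -comp_assoc (comp_assoc _ v) uv comp_idl.
  split; rewrite ?cancel //.
  rewrite -!comp_assoc -!comp_addr !comp_assoc -!comp_addl b5.
  by rewrite comp_idl vu.
by have [/(equivalence_zero_inv EY)|/(equivalence_zero_inv EZ)] :=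
  ind _ _ (GE EY) (GE EZ) bX; [left|right].
Qed.

Lemma equivalence_projective (X : A) :
  E X -> projective_in E' (F X) -> projective_in E X.
Proof.
move=> EX [_ pr]; split=> // L M N f g exE h.
have [EL EM EN _] := exE.
have exE' : exact_in E' (fmap F f) (fmap F g).
  by split; [exact: FE | exact: FE | exact: FE | exact: F_exact].
have [h1 gh1] := pr _ _ _ _ _ exE' (fmap F h).
have [v [vu uv]] := unit_iso EM.
exists (v \oc fmap G h1 \oc adj_unit adj X).
apply: (iso_mono (unit_iso EN)).
rewrite comp_assoc unit_natural -!comp_assoc (comp_assoc _ v) uv comp_idl.
by rewrite comp_assoc -fmap_comp gh1 -unit_natural.
Qed.

Lemma equivalence_ending_almost_split :
  ending_almost_split E' -> ending_almost_split E.
Proof.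
move=> ass N indN nproj; have [EN _ _] := indN.
have [|L [M [f [g [exE' [nsf lf] [nsg rg]]]]]] :=
  ass (F N) (equivalence_indecomposable indN).
  by move=> /(equivalence_projective EN).
have [EL EM EFN ex] := exE'.
have [v [vu uv]] := unit_iso EN.
have iv : is_iso v by exists (adj_unit adj N).
have iL := counit_iso EL; have [cL [cL1 cL2]] := iL.
have unitv (T : A) (h : Hom T N) : v \oc fmap G (fmap F h) \oc adj_unit adj T = h.
  by rewrite -comp_assoc -unit_natural comp_assoc vu comp_idl.
exists (G L), (G M), (fmap G f), (v \oc fmap G g); split; first split.
- exact: GE.
- exact: GE.
- exact: EN.
- exact: short_exact_iso_r iv (G_exact exE').
- split=> [[r rf]|Z h EZ nsh].
    (* Conjugating with the counits turns a retraction of [fmap G f] into one of [f]. *)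
    apply: nsf; exists (adj_counit adj L \oc fmap F r \oc sval
      (constructive_indefinite_description _ (counit_iso EM))).
    case: constructive_indefinite_description => cM [cM1 cM2] /=.
    have cMf : cM \oc f = fmap F (fmap G f) \oc cL.
      apply: (iso_mono (counit_iso EM)).
      by rewrite comp_assoc cM2 comp_idl comp_assoc counit_natural -comp_assoc
        cL2 comp_idr.
    by rewrite -comp_assoc cMf -comp_assoc (comp_assoc _ (fmap F (fmap G f)))
      -fmap_comp rf fmap_id comp_idl.
  pose h1 := fmap F h \oc cL.
  (* By the triangle identity the inverse counit becomes a unit under [G], so [h1] goes back to [h]
     up to the unit of [Z]. *)
  have GcL : fmap G cL = adj_unit adj (G L).
    rewrite -[LHS]comp_idr -(triangle_right adj L) comp_assoc -fmap_comp cL1.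
    by rewrite fmap_id comp_idl.
  have Gh1 : fmap G h1 = adj_unit adj Z \oc h.
    by rewrite fmap_comp GcL -unit_natural.
  have [|h2 h2f] := lf (F Z) h1 (FE EZ).
    move=> [r rh]; apply: nsh; exists (fmap G r \oc adj_unit adj Z).
    by rewrite -comp_assoc -Gh1 -fmap_comp rh fmap_id.
  have [vZ [vZ1 vZ2]] := unit_iso EZ.
  exists (vZ \oc fmap G h2).
  by rewrite -comp_assoc -fmap_comp h2f Gh1 comp_assoc vZ1 comp_idl.
split=> [[s gs]|Z h EZ nsh].
  apply: nsg; exists (adj_counit adj M \oc fmap F s).
  have Ggs : fmap G g \oc s = adj_unit adj N.
    by rewrite -[LHS]comp_idl -uv -!comp_assoc (comp_assoc v) gs comp_idr.
  by rewrite comp_assoc -counit_natural -comp_assoc -fmap_comp Ggs triangle_left.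
have [|h1 gh1] := rg (F Z) (fmap F h) (FE EZ).
  have [vZ [vZ1 vZ2]] := unit_iso EZ.
  move=> [s hs]; apply: nsh; exists (vZ \oc fmap G s \oc adj_unit adj N).
  apply: (iso_mono (unit_iso EN)).
  rewrite comp_assoc unit_natural -!comp_assoc (comp_assoc _ vZ) vZ2 comp_idl.
  by rewrite comp_assoc -fmap_comp hs fmap_id comp_idl comp_idr.
exists (fmap G h1 \oc adj_unit adj Z).
by rewrite comp_assoc -(comp_assoc v) -fmap_comp gh1 unitv.
Qed.

End Equivalence.

Section Main.
Variables (A : preadditive) (nu nui : functor A A) (adj : adjunction nu nui).
Variables (P I : A -> Prop).
Hypothesis dim1 : nakayama_dim1 adj P I.

Lemma subobject_starting_almost_split :
  krull_schmidt (whole A) -> starting_almost_split (whole A) ->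
  starting_almost_split (subobject_of P).
Proof.
apply: sub_starting_almost_split; first exact: (dim1_abelian dim1).
- exact: (subobject_extension_closed dim1).
- by move=> X Y m; exact: subobject_of_mono.
- exact: (subobject_approximation dim1).
Qed.

End Main.

Lemma subobject_almost_split (A : preadditive) (nu nui : functor A A)
    (adj : adjunction nu nui) (P I : A -> Prop) :
  nakayama_dim1 adj P I -> has_almost_split_sequences (whole A) ->
  has_almost_split_sequences (subobject_of P).
Proof.
move=> dim1 [ksA _ endA startA]; have dim1' := op_nakayama_dim1 dim1.
split.
- by apply: krull_schmidt_sub ksA => X Y m; exact: subobject_of_mono.
- exact: (subobject_extension_closed dim1).
- apply: (equivalence_ending_almost_split (adj := adj) (E' := quotient_of I)).
  + by move=> X _; exact: (nu_quotient dim1).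
  + by move=> X _; exact: (nui_subobject dim1).
  + exact: (subobject_unit_iso dim1).
  + move=> X qX; apply: is_iso_op.
    exact: (subobject_unit_iso dim1').
  + by move=> X Y Z f g [_ _ sZ]; exact: (nu_short_exact dim1).
  + by move=> X Y Z f g [qX _ _]; exact: (nui_short_exact dim1).
  (* In [op A] the class [quotient_of I] unfolds to [subobject_of I], so the starting case applies
     to the dual data. *)
  + apply: starting_almost_split_op.
    apply: (subobject_starting_almost_split dim1').
      exact: op_krull_schmidt.
    exact: op_ending_almost_split.
- exact: (subobject_starting_almost_split dim1).
Qed.

Lemma has_almost_split_op (A : preadditive) (E : A -> Prop) :
  @has_almost_split_sequences (op A) E -> has_almost_split_sequences E.
Proof.
move=> [ks ext en st]; split.
- exact: krull_schmidt_op.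
- exact: extension_closed_op.
- exact: starting_almost_split_op.
- exact: ending_almost_split_op.
Qed.

Lemma op_has_almost_split (A : preadditive) (E : A -> Prop) :
  has_almost_split_sequences E -> @has_almost_split_sequences (op A) E.
Proof.
move=> [ks ext en st]; split.
- exact: op_krull_schmidt.
- exact: op_extension_closed.
- exact: op_starting_almost_split.
- exact: op_ending_almost_split.
Qed.

(** * Nakayama functors of dimension at most one *)

Lemma exact_pair_op (C : preadditive) (X Y Z : C) (f : Hom X Y) (g : Hom Y Z) :
  @exact_pair (op C) Z Y X g f -> exact_pair f g.
Proof. by move=> [gf fg]; split=> // K L k c gk cf; exact: (fg L K c k). Qed.

Lemma op_exact_pair (C : preadditive) (X Y Z : C) (f : Hom X Y) (g : Hom Y Z) :
  exact_pair f g -> @exact_pair (op C) Z Y X g f.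
Proof. by move=> [gf fg]; split=> // K L k c gk cf; exact: (fg L K c k). Qed.

(** Stated for a general adjunction to serve twice: for f_! and f^* with [nu], and in opposite
    categories for f^* and f_* with [nu_inv]. *)
Lemma relative_acyclic (A C : preadditive) (abA : abelian A)
    (F : functor C A) (U : functor A C) (adj : adjunction F U)
    (nu : functor A A) (P : A -> Prop) :
  faithful U -> preserves_cokernels U -> preserves_cokernels nu ->
  (forall (X Y : A) (f : Hom X Y), mono f -> mono (fmap nu (fmap F (fmap U f)))) ->
  (forall X, P (F X)) ->
  (forall Q, P Q -> exists X (i : Hom Q (F X)) (p : Hom (F X) Q),
    p \oc i = idm Q) ->
  (forall (X : A) (Q : nat -> A) (d : forall i, Hom (Q i.+1) (Q i))
      (e : Hom (Q 0%N) X),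
    (forall i, P (Q i)) -> epi e -> exact_pair (d 0%N) e ->
    (forall i, exact_pair (d i.+1) (d i)) ->
    exact_pair (fmap nu (d 2%N)) (fmap nu (d 1%N))) ->
  forall X, subobject_of P X -> acyclic nu X.
Proof.
move=> faithU cokU coknu nuT_mono PF Pretract vanish X [Q [m [PQ mm]]].
have P_acyclic R : P R -> acyclic nu R.
  move=> /Pretract [Y [i [p pi1]]]; have [s es] := counit_split adj pi1.
  apply: (@split_counit_acyclic A A _ _ nu _ (comp_functor F U)
    (adj_counit adj) _ _ _ _ R s) => //.
  - by move=> S T V f g /cokU /(left_adjoint_cokernel adj).
  - by move=> S T f; exact: counit_natural.
  - by move=> S; exact: faithful_counit_epi.
apply: subobject_acyclic vanish _ _ m PQ mm => // Y.
exists (F (U Y)), (adj_counit adj Y); split; first exact: PF.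
exact: faithful_counit_epi.
Qed.

Lemma summand_self (C : preadditive) (X : C) : abelian C -> is_summand X X.
Proof.
move=> [[O zO] _]; exists O, (idm X), 0, (idm X), 0.
split; rewrite ?comp_idl ?comp0l ?comp0r ?addr0 //.
by have /is_zero_idm -> := zO.
Qed.

Lemma essential_image_self (C D : preadditive) (F : functor C D) (X : C) :
  in_essential_image F (F X).
Proof. by exists X, (idm (F X)), (idm (F X)); rewrite comp_idl. Qed.

Lemma image_summand_retract (C D : preadditive) (F : functor C D) (Q Y : D) :
  in_essential_image F Y -> is_summand Q Y ->
  exists X (i : Hom Q (F X)) (p : Hom (F X) Q), p \oc i = idm Q.
Proof.
move=> [X [f [g [gf fg]]]] [Z /biproduct_retract [i [p pi1]]].
exists X, (g \oc i), (p \oc f).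
by rewrite -comp_assoc (comp_assoc f) fg comp_idl.
Qed.

Lemma essential_image_summand (B C D : preadditive) (F : functor B C)
    (G : functor C D) (H : functor B D) (Q Y : C) :
  (forall X, isomorphic (H X) (G (F X))) ->
  in_essential_image F Y -> is_summand Q Y ->
  exists Z, in_essential_image H Z /\ is_summand (G Q) Z.
Proof.
move=> HGF [X [f fi]] [Q' bi]; exists (G Y); split.
  have [h hi] := HGF X; exists X, (fmap G f \oc h).
  by apply: iso_comp => //; exact: fmap_iso.
by exists (G Q'); exact: fmap_biproduct.
Qed.

Section NakayamaDim1.
Variables (A C : preadditive) (abA : abelian A).
Variables (fS : functor C A) (fU : functor A C) (adj : adjunction fS fU).
Hypothesis faithU : faithful fU.
Variable N : nakayama adj.

Local Notation fL := (comp_functor (nu N) fS).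
Local Notation P := (rel_projective fS).
Local Notation I := (rel_injective N).

Lemma rel_projective_fS (X : C) : P (fS X).
Proof.
by exists (fS X); split; [exact: essential_image_self | exact: summand_self].
Qed.

Lemma rel_injective_fL (X : C) : I (fL X).
Proof.
exists (fL X); split; last exact: summand_self.
exact: (@essential_image_self _ _ fL).
Qed.

(** The Nakayama condition concerns the unit; the triangle identity carries it over to the counit on
    the image of f_*. *)
Lemma counit_fL_iso (X : C) : is_iso (adj_counit (nu_adj N) (fL X)).
Proof.
have tri := triangle_left (nu_adj N) (fS X).
have iso_nu := fmap_iso (nu N) (nu_unit_iso N X).
exists (fmap (nu N) (adj_unit (nu_adj N) (fS X))); split; last exact: tri.
apply: (iso_epi iso_nu).
by rewrite -comp_assoc tri comp_idl comp_idr.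
Qed.

Lemma rel_projective_unit (Q : A) : P Q -> is_iso (adj_unit (nu_adj N) Q).
Proof.
move=> [Y [imY /(image_summand_retract imY) [X [i [p pi1]]]]].
exact: unit_iso_retract pi1 (nu_unit_iso N X).
Qed.

Lemma rel_injective_counit (J : A) : I J -> is_iso (adj_counit (nu_adj N) J).
Proof.
move=> [Y [imY /(image_summand_retract imY) [X [i [p pi1]]]]].
exact: counit_iso_retract pi1 (counit_fL_iso X).
Qed.

Lemma rel_projective_nu (Q : A) : P Q -> I (nu N Q).
Proof.
move=> [Y [imY sQ]]; apply: essential_image_summand imY sQ => X.
by exists (idm _), (idm _); rewrite comp_idl.
Qed.

Lemma rel_injective_nui (J : A) : I J -> P (nu_inv N J).
Proof.
move=> [Y [imY sJ]]; apply: essential_image_summand imY sJ => X.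
by exists (adj_unit (nu_adj N) (fS X)); exact: nu_unit_iso.
Qed.

Variable n : nat.
Hypotheses (vanish : derived_vanish_above N n) (n_le1 : (n <= 1)%N).

Lemma rel_projective_acyclic (X : A) :
  subobject_of P X -> acyclic (nu N) X.
Proof.
apply: (relative_acyclic abA adj) => //.
(* f^* is also a left adjoint, namely of f_*. *)
- by move=> ? ? ? ? ?; exact: (left_adjoint_cokernel (nu_fS_adj N)).
- by move=> ? ? ? ? ?; exact: (left_adjoint_cokernel (nu_adj N)).
(* nu f_! f^* is f_* f^*, a composite of two right adjoints. *)
- move=> Y Z f fm; apply: (right_adjoint_mono (nu_fS_adj N)).
  exact: (right_adjoint_mono adj).
- exact: rel_projective_fS.
- by move=> Q [Y [imY /(image_summand_retract imY)]].
move=> Z Q d e PQ ee ex0 ex; apply: exact_pair_of_homology => //.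
  by rewrite -fmap_comp (ex 1%N).1 fmap0.
(* Degree 2 lies above [n]: [n < 2] computes to [n <= 1]. *)
move=> H homH; have [+ _] := vanish (j := 2) n_le1 Z H; apply.
exists Q, d, e; split=> //; split=> //; first exact: exact_at_of_pair.
by move=> i; exact: exact_at_of_pair.
Qed.

Lemma rel_injective_coacyclic (X : A) :
  quotient_of I X -> coacyclic (nu_inv N) X.
Proof.
have opU : faithful (op_functor fU) by move=> Y Z f g; exact: faithU.
move=> qX K Y i p /op_short_exact; suff ac : @acyclic (op A) (op A)
  (op_functor (nu_inv N)) X by exact: ac.
apply: (@relative_acyclic (op A) (op C) (op_abelian abA) _ _
  (op_adjunction (nu_fS_adj N)) _ I opU) qX.
- by move=> ? ? ? ? ?; exact: (right_adjoint_kernel adj).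
- by move=> ? ? ? ? ?; exact: (right_adjoint_kernel (nu_adj N)).
(* Dually, nu^- f_* f^* must preserve epis: the unit identifies nu^- f_* with f_!, and both f_! and
   f^* are left adjoints. *)
- move=> V W f fe; set h := fmap fS (fmap fU f).
  have he : epi h.
    by apply: (left_adjoint_epi adj); exact: (left_adjoint_epi (nu_fS_adj N)).
  apply: (@epi_of_comp A _ _ _ _ (adj_unit (nu_adj N) (fS (fU W)))).
  rewrite -(unit_natural (nu_adj N) h); apply: epi_comp he.
  exact: iso_epi (nu_unit_iso N _).
- exact: rel_injective_fL.
- move=> J [Z [imZ /(image_summand_retract imZ) [V [j [q qj]]]]].
  by exists V, q, j.
move=> Z J d e IJ ee ex0 ex; apply: op_exact_pair.
apply: exact_pair_of_homology => //.
  by rewrite -fmap_comp; have /exact_pair_op [-> _] := ex 1%N; rewrite fmap0.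
move=> H homH; have [_ +] := vanish (j := 2) n_le1 Z H; apply.
exists J, d, e; split=> //; split=> //.
  by apply: exact_at_of_pair => //; exact: exact_pair_op.
by move=> k; apply: exact_at_of_pair => //; exact: exact_pair_op.
Qed.

Lemma nakayama_dim1_of_gorenstein : nakayama_dim1 (nu_adj N) P I.
Proof.
split.
- exact: abA.
- move=> X; exists (fS (fU X)), (adj_counit adj X); split.
    exact: rel_projective_fS.
  exact: faithful_counit_epi.
- move=> X; exists (fL (fU X)), (adj_unit (nu_fS_adj N) X); split.
    exact: rel_injective_fL.
  have opU : faithful (op_functor fU) by move=> Y Z f g; exact: faithU.
  exact: (faithful_counit_epi (adj := op_adjunction (nu_fS_adj N)) opU).
- exact: rel_projective_nu.
- exact: rel_injective_nui.
- exact: rel_projective_unit.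
- exact: rel_injective_counit.
- exact: rel_projective_acyclic.
- exact: rel_injective_coacyclic.
Qed.

Let dim1 := nakayama_dim1_of_gorenstein.
Let dim1' := op_nakayama_dim1 dim1.

(** An equality of predicates, obtained by extensionality, so that it can be rewritten inside
    [has_almost_split_sequences]. *)
Lemma Gproj_subobject : Gproj N = subobject_of P.
Proof.
apply: functional_extensionality => X; apply: propositional_extensionality.
split=> [[Q [d [PQ _ _ [k kk]]]]|].
  by exists (Q 0), k; split=> //; exact: kernel_mono kk.
apply: splice_complex => // Y sY.
  exact: (subobject_left_step dim1 sY).
exact: (subobject_right_step dim1 sY).
Qed.

Lemma Ginj_quotient : Ginj N = quotient_of I.
Proof.
apply: functional_extensionality => X; apply: propositional_extensionality.
split=> [[J [d [IJ exJ _ [k kk]]]]|].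
  (* [Ginj] is defined by kernels, not by the dual cokernels; exactness in degree 0, which is
     [exJ 1], presents that kernel as a quotient of [J 1]. *)
  have [e [ee _]] := exact_at_epi abA (exJ 1) kk.
  by exists (J 1), e.
apply: splice_complex => // Y qY.
  (* Passing to [op] reverses the sequences, so the dual right step serves as the left step and
     conversely. *)
  have [Z [J [i [p [IJ qZ ex1 ex2]]]]] := subobject_right_step dim1' qY.
  by exists Z, J, p, i; split=> //; exact: short_exact_op.
have [Z [J [i [p [IJ qZ ex1 ex2]]]]] := subobject_left_step dim1' qY.
by exists Z, J, p, i; split=> //; exact: short_exact_op.
Qed.

End NakayamaDim1.

Local Close Scope ring_scope.

Theorem corollary6p16 (A C : preadditive)
  (abelA : abelian A) (abelC : abelian C)
  (fS : functor C A) (fU : functor A C) (adj : adjunction fS fU)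
  (faithU : faithful fU)
  (N : nakayama adj)
  (ksA : krull_schmidt (whole A))
  (assA : has_almost_split_sequences (whole A))
  (n : nat) (dimN : iwanaga_gorenstein_of_dim N n) (hn : n <= 1) :
  has_almost_split_sequences (Gproj N) /\ has_almost_split_sequences (Ginj N).
Proof.
have [vanish _] := dimN.
have dim1 := nakayama_dim1_of_gorenstein abelA faithU vanish hn.
rewrite (Gproj_subobject abelA faithU vanish hn).
rewrite (Ginj_quotient abelA faithU vanish hn).
split; first exact: subobject_almost_split dim1 assA.
apply: has_almost_split_op.
exact: subobject_almost_split (op_nakayama_dim1 dim1) (op_has_almost_split assA).
Qed.
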